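(* Suppose (A1), (A2), (A3) (either (A3i) or (A3ii)) and (A4) hold, and that $\epsilon(\theta)$ is either of the two exploration gains (a), (b) in the context, with parameter $\epsilon_\bullet>0$. Let $f(\theta,\xi)=-\xi\,\Gamma(\theta+\epsilon(\theta)\xi)/\epsilon(\theta)$ and $\bar f(\theta)=\mathsf{E}[f(\theta,\xi_n)]$. Then there is $\epsilon_\bullet^a>0$ such that the following hold for any $\epsilon_\bullet\in(0,\epsilon_\bullet^a]$: (i) The mean flow $\frac{d}{dt}\vartheta_t=\bar f(\vartheta_t)$ is exponentially asymptotically stable, with stationary point $\theta^*$. (ii) $A^*=\partial\bar f(\theta^* )$ (the Jacobian of $\bar f$ at $\theta^*$) is a Hurwitz matrix.
   Context: Setting. $\Gamma:\mathbb{R}^d\to\mathbb{R}$ is an objective function; $\bar f$ is the mean vector field of the 1SPSA recursion $\theta_{n+1}=\theta_n-\alpha_{n+1}\frac{1}{\epsilon(\theta_n)}\xi_{n+1}\Gamma(\theta_n+\epsilon(\theta_n)\xi_{n+1})$. Exploration gain: $\epsilon:\mathbb{R}^d\to(0,\infty)$ is one of the following two functions, with $\epsilon_\bullet>0$ fixed: (a) $\epsilon(\theta)=\epsilon_\bullet\sqrt{1+\|\theta-\theta^{\rm ctr}\|^2/\sigma_p^2}$ with $\theta^{\rm ctr}\in\mathbb{R}^d$ and $\sigma_p>0$ fixed; or (b) $\epsilon(\theta)=\epsilon_\bullet\sqrt{1+\Gamma(\theta)-\Gamma^-}$, where $\Gamma^-\in\mathbb{R}$ is such that $\Gamma(\theta)\ge\Gamma^-$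 for all $\theta$. Assumptions: (A1) $\alpha_n=\min\{\alpha_0,n^{-\rho}\}$ with $\rho\in(1/2,1)$ and $\alpha_0>0$. (A2) $\Gamma$ is twice continuously differentiable, its first and second derivatives are globally Lipschitz continuous, and there is $\delta>0$ such that $\|\nabla\Gamma(\theta)\|\ge\delta\|\theta\|$ whenever $\|\theta\|\ge\delta^{-1}$. (A3) $\{W_n:n\ge0\}$ is a zero-mean i.i.d. sequence taking values in a compact subset of $\mathbb{R}^d$, with $\mathsf{E}[W_n^iW_n^jW_n^k]=0$ for all $1\le i\le j\le k\le d$ (superscripts denote components) and $\Sigma_W=\mathsf{E}[W_nW_n^\intercal]>0$ (positive definite). The exploration sequence is, for $n\ge1$, either (A3i) i.i.d.: $\xi_n=W_n$; or (A3ii) zig-zag: $\xi_n=\varsigma[W_n-W_{n-1}]$ with a constant $\varsigma>0$. (A4) The gradient flow $\frac{d}{dt}x_t=-\nabla\Gamma(x_t)$ is globally exponentially asymptotically stable, with $\theta^{\rm opt}$ its unique stationary point, and $\nabla^2\Gamma(\theta^{\rm opt})$ is positive definite. Exponential asymptotic stability of an ODE to an equilibrium $x^*$: there are $b<\infty$, $\varrho>0$ with $\|x_t-x^*\|\le b\|x_0-x^*\|e^{-\varrho t}$ for all $t\ge0$ and all $x_0\in\mathbb{R}^d$. Hurwitz: all eigenvalues have strictly negative real part. *)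

(* Defs.v *)
From HB Require Import structures.
From mathcomp Require Import all_boot all_order all_algebra.
From mathcomp Require Import all_classical all_reals all_analysis.
From mathcomp Require Import complex.
Import Order.TTheory GRing.Theory Num.Theory.
Import numFieldNormedType.Exports.

Set Implicit Arguments.
Unset Strict Implicit.
Unset Printing Implicit Defensive.

Local Open Scope classical_set_scope.
Local Open Scope ring_scope.

Section calculus.
Context {R : realType} {d : nat}.
Implicit Types (x v : 'rV[R]_d) (S : 'M[R]_d) (g : 'rV[R]_d -> R).

(* The library norm `|x| on matrices is the sup norm; it only enters through
   `lipschitz`, where the two norms differ by the constant. *)
Definition enorm x : R := Num.sqrt (\sum_(i < d) x 0 i ^+ 2).

Definition grad g x : 'rV[R]_d := \row_i 'D_(delta_mx 0 i) g x.

Definition hessian g x : 'M[R]_d :=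
  \matrix_(i, j) 'D_(delta_mx 0 j) (fun y => grad g y 0 i) x.

(* The library Jacobian 'J F x acts on row vectors from the right
   ('d F x v = v *m 'J F x), so it is the transpose of (dF_i/dx_j)_(i,j). *)
Definition jac (F : 'rV[R]_d -> 'rV[R]_d) x : 'M[R]_d := ('J F x)^T.

Definition posdef S : Prop :=
  S^T = S /\ forall v, v != 0 -> 0 < (v *m S *m v^T) 0 0.

Definition hurwitz S : Prop :=
  forall z : R[i], eigenvalue (map_mx (real_complex R) S) z -> complex.Re z < 0.

End calculus.

Section ode.
Context {R : realType} {d : nat}.
Implicit Types (F : 'rV[R]_d -> 'rV[R]_d) (x : R -> 'rV[R]_d).

(* Values of x at negative times are irrelevant. *)
Definition ode_solution F x : Prop :=
  {within `[0, +oo[, continuous x} /\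
  forall t : R, 0 < t -> is_derive t 1 x (F (x t)).

(* The first clause says that the flow x_t is defined for all t >= 0 and every
   initial condition; the second one bounds every solution. *)
Definition exp_stable F (xs : 'rV[R]_d) : Prop :=
  (forall x0 : 'rV[R]_d, exists2 x, ode_solution F x & x 0 = x0) /\
  exists b rate : R, 0 < rate /\
    forall x, ode_solution F x -> forall t : R, 0 <= t ->
      enorm (x t - xs) <= b * enorm (x 0 - xs) * expR (- (rate * t)).

End ode.

Section probability.
Context {R : realType} {d : nat} {dO : measure_display}.
Context {Omega : measurableType dO} (P : probability Omega R).
Implicit Types (X : Omega -> 'rV[R]_d) (W xi : nat -> Omega -> 'rV[R]_d).

Definition borel_rV : set (set 'rV[R]_d) := <<s open >>.

Definition random_vector X : Prop :=
  forall B, borel_rV B -> measurable (X @^-1` B).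

Definition mutually_independent W : Prop :=
  forall (s : seq nat) (B : nat -> set 'rV[R]_d),
    uniq s -> (forall n, borel_rV (B n)) ->
    P (\bigcap_(n in [set` s]) (W n @^-1` B n)) =
    (\prod_(n <- s) P (W n @^-1` B n))%E.

Definition identically_distributed W : Prop :=
  forall n B, borel_rV B -> P (W n @^-1` B) = P (W 0%N @^-1` B).

Definition iid W : Prop :=
  [/\ forall n, random_vector (W n), mutually_independent W
    & identically_distributed W].

Definition second_moment X : 'M[R]_d :=
  \matrix_(i, j) fine (expectation P (fun w => X w 0 i * X w 0 j)).

Definition probing_noise W : Prop :=
  [/\ iid W,
      exists2 K : set 'rV[R]_d, compact K & forall n w, K (W n w),
      forall n i, expectation P (fun w => W n w 0 i) = 0%E,
      forall n (i j k : 'I_d), (i <= j)%N -> (j <= k)%N ->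
        expectation P (fun w => W n w 0 i * W n w 0 j * W n w 0 k) = 0%E
    & forall n, posdef (second_moment (W n))].

Definition iid_exploration W xi : Prop :=
  forall n, (1 <= n)%N -> xi n = W n.

Definition zigzag_exploration W xi : Prop :=
  exists2 c : R, 0 < c &
    forall n, (1 <= n)%N -> xi n = (fun w => c *: (W n w - W n.-1 w)).

Definition exploration_sequence W xi : Prop :=
  probing_noise W /\ (iid_exploration W xi \/ zigzag_exploration W xi).

End probability.

Section spsa.
Context {R : realType} {d : nat}.
Implicit Types (Gamma : 'rV[R]_d -> R) (alpha : nat -> R).

Definition step_size_schedule alpha (rho : R) : Prop :=
  [/\ 1 / 2 < rho < 1, 0 < alpha 0%N
    & forall n, (1 <= n)%N -> alpha n = Num.min (alpha 0%N) (n%:R `^ (- rho))].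

Definition regular_objective Gamma : Prop :=
  [/\ [/\ forall x, differentiable Gamma x,
          forall x, differentiable (grad Gamma) x
        & continuous (hessian Gamma)],
      lipschitz (grad Gamma),
      lipschitz (hessian Gamma)
    & exists2 delta : R, 0 < delta &
        forall x, delta^-1 <= enorm x -> delta * enorm x <= enorm (grad Gamma x)].

Definition stable_gradient_flow Gamma (theta_opt : 'rV[R]_d) : Prop :=
  [/\ exp_stable (fun x => - grad Gamma x) theta_opt,
      forall x, grad Gamma x = 0 <-> x = theta_opt
    & posdef (hessian Gamma theta_opt)].

Definition gain_a (ctr : 'rV[R]_d) (sigma eb : R) (theta : 'rV[R]_d) : R :=
  eb * Num.sqrt (1 + enorm (theta - ctr) ^+ 2 / sigma ^+ 2).

Definition gain_b Gamma (Gmin eb : R) (theta : 'rV[R]_d) : R :=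
  eb * Num.sqrt (1 + Gamma theta - Gmin).

Definition exploration_gain Gamma (eps : R -> 'rV[R]_d -> R) : Prop :=
  (exists ctr sigma, 0 < sigma /\ eps = gain_a ctr sigma) \/
  (exists Gmin, (forall theta, Gmin <= Gamma theta) /\ eps = gain_b Gamma Gmin).

Definition spsa_field Gamma (eps : 'rV[R]_d -> R) (theta xi : 'rV[R]_d) :
    'rV[R]_d :=
  - (Gamma (theta + eps theta *: xi) / eps theta) *: xi.

Definition mean_field {dO : measure_display} {Omega : measurableType dO}
    (P : probability Omega R) (f : 'rV[R]_d -> 'rV[R]_d -> 'rV[R]_d)
    (xi : Omega -> 'rV[R]_d) (theta : 'rV[R]_d) : 'rV[R]_d :=
  \row_i fine (expectation P (fun w => f theta (xi w) 0 i)).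

End spsa.

(* Main.v *)
(* The mean field is [- grad Gamma *m S] plus a bias, where [S] is the covariance
   of the noise. Since the Hessian is Lipschitz, mixed second differences of the
   gradient are bounded by a product of norms; hence the bias is Lipschitz at
   each point of a bounded set with constant [O(eb)], uniformly over the whole
   space in the other argument. So the simplified Newton map is a contraction
   near the minimiser of [Gamma] and yields the equilibrium [xs].

   The gradient flow shows that [Gamma] grows quadratically around its minimiser,
   and, with the coercivity at infinity, that [|grad Gamma x| >= c |x - xo|]
   everywhere. The same second differences carry both estimates over to the
   Bregman divergence of [Gamma] at [xs] and to its gradient, so this divergence
   is a global Lyapunov function with exponential decay. The quadratic form of
   the Hessian at the minimiser is a Lyapunov function for the Jacobian. *)
Require Import Defs.
From HB Require Import structures.
From mathcomp Require Import all_boot all_order all_algebra.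
From mathcomp Require Import all_classical all_reals all_analysis.
From mathcomp Require Import complex ring lra measurable_realfun.
Import Order.TTheory GRing.Theory Num.Theory.
Import numFieldNormedType.Exports.

Set Implicit Arguments.
Unset Strict Implicit.
Unset Printing Implicit Defensive.

Local Open Scope classical_set_scope.
Local Open Scope ring_scope.

(** * Vectors and matrices *)

Section dot_product.
Context {R : realType} {d : nat}.
Implicit Types (u v w x : 'rV[R]_d) (A : 'M[R]_d).

(** The obstacle is that the gain grows linearly at infinity, so the bias need not be uniformly
    small; only its increments from a bounded point are controlled by [eb] times a distance. The
    field is therefore always compared with its value at the equilibrium, which has to be located
    near the minimiser before a Lyapunov function can be centred there. The factor [S] does no harm:
    pairing [- g *m S] with [g] gives at most [- lam |g|^2] for every positive definite [S]. The
    smallness parameters have an order: a radius [r] depends on [Gamma] and [S] only, and the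
    threshold on [eb] depends on [r]. One equilibrium must serve all [n], which for zig-zag
    exploration requires the pairs [(W n, W n.-1)] to share one law; this comes from a
    discretisation by finite nets. Differentiability of the mean field is obtained from quadratic
    Taylor errors, which pass through the expectation, instead of differentiating under it. *)

Definition dotp u v : R := \sum_i u 0 i * v 0 i.

Lemma dotpC u v : dotp u v = dotp v u.
Proof. by apply: eq_bigr => i _; rewrite mulrC. Qed.

Lemma dotpDl u v w : dotp (u + v) w = dotp u w + dotp v w.
Proof. by rewrite -big_split; apply: eq_bigr => i _ /=; rewrite mxE mulrDl. Qed.

Lemma dotpZl a u v : dotp (a *: u) v = a * dotp u v.
Proof. by rewrite mulr_sumr; apply: eq_bigr => i _; rewrite mxE mulrA. Qed.

Lemma dotpNl u v : dotp (- u) v = - dotp u v.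
Proof. by rewrite -scaleN1r dotpZl mulN1r. Qed.

Lemma dotpBl u v w : dotp (u - v) w = dotp u w - dotp v w.
Proof. by rewrite dotpDl dotpNl. Qed.

Lemma dotpDr u v w : dotp w (u + v) = dotp w u + dotp w v.
Proof. by rewrite dotpC dotpDl !(dotpC w). Qed.

Lemma dotpZr a u v : dotp v (a *: u) = a * dotp v u.
Proof. by rewrite dotpC dotpZl dotpC. Qed.

Lemma dotpNr u v : dotp v (- u) = - dotp v u.
Proof. by rewrite dotpC dotpNl dotpC. Qed.

Lemma dotpBr u v w : dotp w (u - v) = dotp w u - dotp w v.
Proof. by rewrite dotpDr dotpNr. Qed.

Lemma dotp0r u : dotp u 0 = 0.
Proof. by rewrite -(scale0r u) dotpZr mul0r. Qed.

Lemma dotpE u v : dotp u v = (u *m v^T) 0 0.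
Proof. by rewrite mxE; apply: eq_bigr => i _; rewrite mxE. Qed.

Lemma dotp_mulmxl u v A : dotp (u *m A) v = dotp u (v *m A^T).
Proof. by rewrite !dotpE trmx_mul trmxK mulmxA. Qed.

Lemma entry_le m n (A : 'M[R]_(m, n)) i j : `|A i j| <= `|A|.
Proof.
rewrite {2}/Num.Def.normr/= mx_normrE.
by apply: (@le_bigmax _ _ _ 0 (fun ij => `|A ij.1 ij.2|) (i, j)).
Qed.

Lemma mxnorm_le m n (A : 'M[R]_(m, n)) c :
  0 <= c -> (forall i j, `|A i j| <= c) -> `|A| <= c.
Proof.
move=> c0 h; rewrite /Num.Def.normr/= mx_normrE.
by apply: bigmax_le => // -[i j] _; exact: h.
Qed.

Lemma rVnorm_le u c : 0 <= c -> (forall i, `|u 0 i| <= c) -> `|u| <= c.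
Proof. by move=> c0 h; apply: mxnorm_le => // i j; rewrite ord1. Qed.

(** The factor [d.+1] instead of [d] keeps the constant at least 1 in every dimension, including 0,
    so that it can be divided by. It is the price of working with the sup norm throughout. *)
Lemma sum_le_dim (F : 'I_d -> R) c : 0 <= c -> (forall i, `|F i| <= c) ->
  `|\sum_i F i| <= d.+1%:R * c.
Proof.
move=> c0 h; apply: le_trans (ler_norm_sum _ _ _) _.
apply: le_trans (_ : \sum_(i < d) c <= _); first exact: ler_sum.
by rewrite sumr_const card_ord -[leLHS]mulr_natl ler_wpM2r// ler_nat.
Qed.

Lemma dotp_le u v : `|dotp u v| <= d.+1%:R * (`|u| * `|v|).
Proof.
apply: sum_le_dim => [|i]; first by rewrite mulr_ge0.
by rewrite normrM ler_pM// entry_le.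
Qed.

Lemma dotp_ge u : `|u| ^+ 2 <= dotp u u.
Proof.
have u0 : 0 <= dotp u u by apply: sumr_ge0 => i _; rewrite -expr2 sqr_ge0.
rewrite -ler_sqrt ?sqrtr_sqr// ?exprn_ge0// normr_id.
apply: rVnorm_le => [|i]; first exact: sqrtr_ge0.
rewrite -sqrtr_sqr ler_sqrt// /dotp (bigD1 i)//= expr2 lerDl.
by apply: sumr_ge0 => j _; rewrite -expr2 sqr_ge0.
Qed.

Lemma enormE u : enorm u = Num.sqrt (dotp u u).
Proof. by congr Num.sqrt; apply: eq_bigr => i _; rewrite expr2. Qed.

Lemma sqr_enorm u : enorm u ^+ 2 = dotp u u.
Proof. by rewrite enormE sqr_sqrtr// (le_trans _ (dotp_ge u))// exprn_ge0. Qed.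

Lemma le_enorm u : `|u| <= enorm u.
Proof.
rewrite enormE -[leLHS]ger0_norm// -sqrtr_sqr ler_sqrt ?dotp_ge//.
by rewrite (le_trans _ (dotp_ge u))// exprn_ge0.
Qed.

Lemma enorm_le u : enorm u <= d.+1%:R * `|u|.
Proof.
have D1 : 1 <= d.+1%:R :> R by rewrite ler1n.
rewrite enormE -[leRHS]ger0_norm ?mulr_ge0// -sqrtr_sqr ler_sqrt ?sqr_ge0//.
apply: le_trans (ler_norm _) _; apply: le_trans (dotp_le u u) _.
rewrite exprMn -expr2 expr2 -mulrA ler_peMl// mulr_ge0// exprn_ge0//.
Qed.

Lemma mulmx_le u A : `|u *m A| <= d.+1%:R * `|A| * `|u|.
Proof.
apply: rVnorm_le => [|i]; first by rewrite !mulr_ge0.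
rewrite mxE -mulrA; apply: sum_le_dim => [|j]; first by rewrite mulr_ge0.
by rewrite normrM mulrC ler_pM// entry_le.
Qed.

Lemma rV_continuous (T : topologicalType) (f : T -> 'rV[R]_d) t :
  (forall i, {for t, continuous (fun s => f s 0 i)}) -> {for t, continuous f}.
Proof.
move=> h; apply/cvgrPdist_le => /= e e0.
near=> s; apply: rVnorm_le (ltW e0) _.
suff H i : `|f t 0 i - f s 0 i| <= e by move=> i; rewrite !mxE; exact: H.
move: i; near: s; apply: filter_forall => i.
by move/cvgrPdist_le : (h i) => /(_ _ e0).
Unshelve. all: by end_near. Qed.

Lemma dotp_differentiable u x : differentiable (dotp u) x.
Proof.
have -> : dotp u = \sum_i (fun v : 'rV[R]_d => u 0 i *: (v 0 i : R)).
  by apply/funext => v; rewrite /dotp fct_sumE.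
apply: differentiable_sum => i; apply: differentiableZ.
exact: differentiable_coord.
Qed.

Lemma dotp_continuous u : continuous (dotp u).
Proof. by move=> x; exact/differentiable_continuous/dotp_differentiable. Qed.

Lemma sum_continuous (T : topologicalType) n (F : 'I_n -> T -> R) t :
  (forall i, {for t, continuous (F i)}) ->
  {for t, continuous (fun s => \sum_i F i s)}.
Proof.
move=> cF; rewrite (_ : (fun _ => _) = \sum_i F i); last first.
  by apply/funext => s; rewrite fct_sumE.
elim/big_ind : _ => [|g h cg ch|i _]; [exact: cvg_cst| |exact: cF].
exact: continuousD.
Qed.

Lemma sqr_dotp_continuous A : continuous (fun v => dotp (v *m A) v).
Proof.
move=> x.
have -> : (fun v => dotp (v *m A) v) =
  (fun v => \sum_i (\sum_j v 0 j * A j i) * v 0 i).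
  by apply/funext => v; apply: eq_bigr => i _; rewrite mxE.
apply: (sum_continuous (F := fun i v => (\sum_j v 0 j * A j i) * v 0 i)) => i.
apply: continuousM; last exact: coord_continuous.
apply: (sum_continuous (F := fun j v => v 0 j * A j i)) => j.
by apply: continuousM; [exact: coord_continuous|exact: cst_continuous].
Qed.

Lemma sphere_compact (r1 r2 : R) (x : 'rV[R]_d) :
  compact [set v | r1 <= `|v - x| <= r2].
Proof.
apply: bounded_closed_compact.
  exists (r2 + `|x|); split; first exact: num_real.
  move=> M rM v /= /andP[_ vr]; apply: le_trans (ltW rM).
  by have := ler_normD (v - x) x; rewrite subrK => /le_trans; apply; rewrite lerD2r.
have cn : continuous (fun v : 'rV[R]_d => `|v - x|).
  move=> v; apply: (@continuous_comp _ _ _ (fun v => v - x) (fun w => `|w|)).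
    by apply: continuousD; [exact: cvg_id|exact: cst_continuous].
  exact: norm_continuous.
rewrite (_ : [set _ | _] = (fun v : 'rV[R]_d => `|v - x|) @^-1` `[r1, r2]%classic).
  by apply: closed_comp; [move=> v _; exact: cn|exact: interval_closed].
by apply/seteqP; split => v /=; rewrite in_itv.
Qed.

Lemma posdef_coercive A : posdef A ->
  exists2 l : R, 0 < l & forall v, l * `|v| ^+ 2 <= dotp (v *m A) v.
Proof.
move=> [_ pA].
have pA' v : v != 0 -> 0 < dotp (v *m A) v by move=> /pA; rewrite dotpE.
pose K : set 'rV[R]_d := [set v | 1 <= `|v - 0| <= 1].
(* The unit sphere is empty exactly in dimension 0, where any constant works. Otherwise the constant
   is the minimum of the form on the sphere, and homogeneity of degree two does the rest. *)
have [K0|/set0P K0] := eqVneq K set0.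
  exists 1 => // v; rewrite mul1r.
  have [->|v0] := eqVneq v 0.
    by rewrite normr0 expr0n mul0mx dotp0r.
  suff : K (`|v|^-1 *: v) by rewrite K0.
  by rewrite /K /= subr0 normrZ ger0_norm ?invr_ge0// mulVf ?lexx ?normr_eq0.
have [c cK cm] := @EVT_min_rV R d (fun v => dotp (v *m A) v) K K0
  (@sphere_compact 1 1 0)
  (continuous_subspaceT (@sqr_dotp_continuous A)).
exists (dotp (c *m A) c).
  apply: pA'; move: cK; rewrite inE /K /= subr0 => /andP[+ _].
  by rewrite -normr_gt0; apply: lt_le_trans.
move=> v; have [->|v0] := eqVneq v 0.
  by rewrite normr0 expr0n/= mulr0 mul0mx dotp0r.
have nv0 : `|v| != 0 by rewrite normr_eq0.
have /cm : `|v|^-1 *: v \in K.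
  by rewrite inE /K /= subr0 normrZ ger0_norm ?invr_ge0// mulVf ?lexx.
rewrite -scalemxAl dotpZl dotpZr mulrA -expr2 mulrC exprVn.
by rewrite -ler_pdivlMr// exprn_gt0// normr_gt0.
Qed.

Lemma coercive_unitmx A (l : R) : 0 < l ->
  (forall v, l * `|v| ^+ 2 <= dotp (v *m A) v) -> A \in unitmx.
Proof.
move=> l0 h; rewrite -row_free_unit -kermx_eq0; apply/eqP/row_matrixP => i.
rewrite row0; have := h (row i (kermx A)).
rewrite (sub_kermxP (row_sub _ _)) dotpC dotp0r pmulr_rle0// => k0.
apply/eqP; rewrite -normr_eq0 -sqrf_eq0; apply/eqP/le_anti.
by rewrite k0 sqr_ge0.
Qed.
End dot_product.

(** * Mean value estimates *)

Section mean_value.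
Context {R : realType} {d : nat}.
Implicit Types (g : 'rV[R]_d -> R) (x v w : 'rV[R]_d).

Lemma MVT01 (f df : R -> R) (C : R) : (forall s : R, is_derive s 1 f (df s)) ->
  (forall s, 0 < s < 1 -> `|df s| <= C) -> `|f 1 - f 0| <= C.
Proof.
move=> h hC; have cf : {within `[0, 1], continuous f}.
  apply: continuous_subspaceT => s; have [dfs _] := h s.
  exact/differentiable_continuous/derivable1_diffP.
have [s s01 ->] := @MVT R f df 0 1 ltr01 (fun s _ => h s) cf.
by rewrite subr0 mulr1; apply: hC; rewrite in_itv in s01.
Qed.

Lemma is_derive_curve (V W : normedModType R) (g : V -> W) (y : R -> V) (s : R) y' :
  is_derive s 1 y y' -> differentiable g (y s) ->
  is_derive s 1 (g \o y) ('d g (y s) y').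
Proof.
move=> [dy <-] dg; have dy' : differentiable y s by exact/derivable1_diffP.
have dgy : differentiable (g \o y) s by exact: differentiable_comp.
by apply: DeriveDef; [exact: diff_derivable|rewrite !deriveE// diff_comp].
Qed.

Lemma is_derive_line x v (s : R) : is_derive s 1 (fun t : R => x + t *: v) v.
Proof.
rewrite -[X in is_derive _ _ _ X]add0r; apply: is_deriveD.
rewrite -[X in is_derive _ _ _ X]scale1r.
have dv : differentiable (fun t : R => t *: v) s by exact: differentiableZl.
apply: DeriveDef; first exact: diff_derivable.
by rewrite deriveE// diff_val.
Qed.

Lemma diff_grad g x v : differentiable g x -> 'd g x v = dotp (grad g x) v.
Proof.
move=> dg; rewrite {1}[v]row_sum_delta linear_sum; apply: eq_bigr => i _ /=.
by rewrite linearZ/= -deriveE// mxE mulrC.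
Qed.

Lemma is_derive_grad g x v (s : R) : (forall y, differentiable g y) ->
  is_derive s 1 (fun t => g (x + t *: v)) (dotp (grad g (x + s *: v)) v).
Proof.
move=> dg; rewrite -diff_grad//.
exact: (is_derive_curve (is_derive_line x v s) (dg _)).
Qed.

Lemma differentiable_entry (F : 'rV[R]_d -> 'rV[R]_d) i x :
  differentiable F x -> differentiable (fun y => F y 0 i) x.
Proof.
move=> dF; apply: (@differentiable_comp _ _ _ _ F (fun M : 'rV[R]_d => M 0 i)) => //.
exact: differentiable_coord.
Qed.

(** Mean value theorem for [g] on the segment minus its linear part, whose derivative is a
    difference of gradients. The factor 1/2 of the integral remainder is given up. *)
Lemma taylor1 g L x v : (forall y, differentiable g y) ->
  (forall y z, `|grad g y - grad g z| <= L * `|y - z|) ->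
  `|g (x + v) - g x - dotp (grad g x) v| <= d.+1%:R * L * `|v| ^+ 2.
Proof.
move=> dg gL.
have h (s : R) : is_derive s 1 (fun t => g (x + t *: v) - t * dotp (grad g x) v)
    (dotp (grad g (x + s *: v)) v - 1 * dotp (grad g x) v).
  apply: is_deriveB; first exact: is_derive_grad.
  by apply: is_derive_eq; rewrite scaler0 add0r -mulr_algr scaler1.
have := MVT01 (C := d.+1%:R * L * `|v| ^+ 2) h.
rewrite scale1r scale0r addr0 mul0r subr0 mul1r addrAC; apply => s /andP[s0 s1].
rewrite -dotpBl (le_trans (dotp_le _ _))// -mulrA ler_wpM2l//.
rewrite expr2 mulrA ler_wpM2r// (le_trans (gL _ _))//.
rewrite addrAC subrr add0r normrZ (ger0_norm (ltW s0)).
(* The sign is read off the Lipschitz bound itself, at [v] and [0]. *)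
have L0 : 0 <= L * `|v|.
  by have := le_trans (normr_ge0 _) (gL v 0); rewrite subr0.
by rewrite mulrCA ler_piMl// ltW.
Qed.

End mean_value.

(** * Second-order estimates for the gradient *)

Section regular_gradient.
Context {R : realType} {d : nat} (Gamma : 'rV[R]_d -> R) (L : R).
Local Notation G := (grad Gamma).
Local Notation H := (hessian Gamma).
Hypothesis L0 : 0 <= L.
Hypothesis dG : forall x, differentiable G x.
Hypothesis HL : forall x y, `|H x - H y| <= L * `|x - y|.

Lemma grad_entry i x : grad (fun y => G y 0 i) x = row i (H x).
Proof. by apply/rowP => j; rewrite !mxE. Qed.

Lemma row_hessian_le i x y : `|row i (H x) - row i (H y)| <= L * `|x - y|.
Proof.
apply: le_trans (HL x y); apply: rVnorm_le => // j.
by apply: le_trans (entry_le _ i j); rewrite !mxE.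
Qed.

(** Along [t * v] the gradient is compared at two points that always differ by [u], so the Hessian
    rows differ by at most [L |u|] however large [v] is. The bound is a product, uniform in [x],
    with no smallness required of [u] or [v]: this is what makes the later comparisons global. *)
Lemma grad_mixed x u v : `|G (x + u + v) - G (x + u) - G (x + v) + G x| <=
  d.+1%:R * L * (`|u| * `|v|).
Proof.
apply: rVnorm_le => [|i]; first by rewrite !mulr_ge0.
have dGi y : differentiable (fun y => G y 0 i) y by exact: differentiable_entry.
have h (s : R) := is_deriveB (is_derive_grad (x + u) v s dGi) (is_derive_grad x v s dGi).
have := MVT01 (C := d.+1%:R * L * (`|u| * `|v|)) h.
rewrite /= !fctE !scale1r !scale0r !addr0.
rewrite (_ : G (x + u + v) 0 i - _ - _ = (G (x + u + v) - G (x + u) - G (x + v) + G x) 0 i).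
  apply => s _; rewrite !grad_entry -dotpBl (le_trans (dotp_le _ _))// -mulrA.
  rewrite ler_wpM2l// mulrA ler_wpM2r// (le_trans (row_hessian_le _ _ _))//.
  by rewrite (addrAC x u) (addrC _ u) addrK.
by rewrite !mxE; ring.
Qed.

(** The Hessian is frozen at [x0] while the base point [x] may move. The transpose comes from the
    row-vector convention; it disappears at the minimiser, where positive definiteness includes
    symmetry. *)
Lemma grad_linearize x0 x v :
  `|G (x + v) - G x - v *m (H x0)^T| <=
  d.+1%:R * L * ((`|x - x0| + `|v|) * `|v|).
Proof.
apply: rVnorm_le => [|i]; first by rewrite !mulr_ge0 ?addr_ge0.
have dGi y : differentiable (fun y => G y 0 i) y by exact: differentiable_entry.
have h (s : R) : is_derive s 1
    (fun t => G (x + t *: v) 0 i - t * dotp (row i (H x0)) v)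
    (dotp (grad (fun y => G y 0 i) (x + s *: v)) v - 1 * dotp (row i (H x0)) v).
  apply: is_deriveB; first exact: is_derive_grad.
  by apply: is_derive_eq; rewrite scaler0 add0r -mulr_algr scaler1.
have := MVT01 (C := d.+1%:R * L * ((`|x - x0| + `|v|) * `|v|)) h.
rewrite scale1r scale0r addr0 mul0r subr0 mul1r addrAC.
have E : dotp (row i (H x0)) v = (v *m (H x0)^T) 0 i.
  by rewrite mxE; apply: eq_bigr => j _; rewrite !mxE mulrC.
rewrite E => mvt.
suff : `|G (x + v) 0 i - G x 0 i - (v *m (H x0)^T) 0 i| <=
    d.+1%:R * L * ((`|x - x0| + `|v|) * `|v|).
  by move: (v *m (H x0)^T) => M; rewrite !mxE.
apply: mvt => s /andP[s0 s1].
rewrite grad_entry -E -dotpBl (le_trans (dotp_le _ _))// -mulrA.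
rewrite ler_wpM2l// mulrA ler_wpM2r// (le_trans (row_hessian_le _ _ _))//.
rewrite ler_wpM2l// addrAC (le_trans (ler_normD _ _))// lerD2l normrZ.
by rewrite (ger0_norm (ltW s0)) ler_piMl// ltW.
Qed.

End regular_gradient.

(** * Lyapunov functions and growth of the objective *)

Section first_order.
Context {R : realType} {d : nat}.
Implicit Types (f V : 'rV[R]_d -> R) (x v : 'rV[R]_d).

(** A quadratic remainder is [o(|v|)]. Such bounds survive expectations and algebraic combinations,
    so this is the way to the differentials of the Lyapunov functions and to the differentiability
    of the mean field. *)
Lemma diff_quadratic_error f x a C :
  (forall v, `|f (x + v) - f x - dotp a v| <= C * `|v| ^+ 2) ->
  differentiable f x /\ forall v, 'd f x v = dotp a v.
Proof.
move=> fC; have alin : linear (dotp a) by move=> k u v; rewrite dotpDr dotpZr.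
pose aM := GRing.isLinear.Build _ _ _ _ _ alin.
pose aL : {linear 'rV[R]_d -> R} := HB.pack (dotp a) aM.
have C0 : 0 <= `|C| + 1 by rewrite addr_ge0.
have fa : f \o shift x = cst (f x) + aL +o_ (0 : 'rV[R]_d) id.
  apply/eqaddoP => e e0; near=> v.
  rewrite !fctE/= opprD addrA [v + x]addrC (le_trans (fC v))//.
  rewrite expr2 mulrA ler_wpM2r// (@le_trans _ _ ((`|C| + 1) * `|v|))//.
    by rewrite ler_wpM2r// (le_trans (ler_norm C))// lerDl.
  rewrite mulrC -ler_pdivlMr ?ltr_pwDr//.
  near: v; apply/nbhs_ballP; exists (e / (`|C| + 1)) => /=.
    by rewrite divr_gt0// ltr_pwDr.
  by move=> v; rewrite -ball_normE/= sub0r normrN => /ltW.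
have da : 'd f x = aL :> (_ -> _).
  by apply: diff_unique fa => //; exact: dotp_continuous.
split; last by move=> v; rewrite da.
apply/diff_locallyP; split; first by rewrite da; exact: dotp_continuous.
by rewrite da.
Unshelve. all: by end_near. Qed.

Lemma sqr_dotp_expand x v c :
  dotp (x + v - c) (x + v - c) - dotp (x - c) (x - c) - dotp (2 *: (x - c)) v
  = dotp v v.
Proof.
rewrite (addrAC x); move: (x - c) => w.
by rewrite dotpDl !dotpDr dotpZl (dotpC v w); ring.
Qed.

Lemma nonincreasing_within (phi dphi : R -> R) :
  {within `[0, +oo[, continuous phi} ->
  (forall t : R, 0 < t -> is_derive t 1 phi (dphi t)) ->
  (forall t : R, 0 < t -> dphi t <= 0) ->
  forall t, 0 <= t -> phi t <= phi 0.
Proof.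
move=> cphi dp np t t0; apply: (@ler0_derive1_nincr _ phi 0 t) => //.
- by move=> s; rewrite in_itv => /andP[s0 _]; have [] := dp s s0.
- move=> s; rewrite in_itv => /andP[s0 _].
  by rewrite derive1E; have [_ ->] := dp s s0; exact: np.
- apply: continuous_subspaceW cphi => s /=; rewrite !in_itv/= andbT.
  by case/andP.
Qed.

(** The function [expR (mu * s) * V (y s)] has a nonpositive derivative. The case [mu = 0] gives
    plain monotonicity and is applied to the gradient flow. *)
Lemma lyapunov_decay (F : 'rV[R]_d -> 'rV[R]_d) V (mu : R) :
  (forall x, differentiable V x) ->
  (forall x, 'd V x (F x) <= - mu * V x) ->
  forall y : R -> 'rV[R]_d, ode_solution F y -> forall t, 0 <= t ->
  V (y t) <= expR (- (mu * t)) * V (y 0).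
Proof.
move=> dV VF y [cy dy] t t0.
rewrite expRN ler_pdivlMl ?expR_gt0//.
rewrite -[leRHS]mul1r -[in leRHS](@expR0 R) -[X in expR X * V (y 0)](mulr0 mu).
pose phi (s : R) := expR (mu * s) * V (y s).
have dm (s : R) : is_derive s 1 (fun s => mu * s) mu.
  by rewrite -[X in is_derive _ _ _ X]mulr1; exact: is_deriveZ.
have de (s : R) := is_derive1_comp (is_derive_expR (mu * s)) (dm s).
apply: (@nonincreasing_within phi (fun s =>
  expR (mu * s) * 'd V (y s) (F (y s)) + V (y s) * (expR (mu * s) * mu))) => //.
- have ce : continuous (expR \o ( *%R mu) : R -> R).
    move=> s; have [des _] := de s.
    exact/differentiable_continuous/derivable1_diffP.
  have ce' : {within `[0, +oo[, continuous (expR \o ( *%R mu) : R -> R)}.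
    exact: continuous_subspaceT.
  have cVy : {within `[0, +oo[, continuous (V \o y)}.
    move=> s; apply: (continuous_comp (cy s)).
    exact/differentiable_continuous/dV.
  by move=> s; exact: (continuousM (ce' s) (cVy s)).
- move=> s s0; exact: is_deriveM (de s) (is_derive_curve (dy s s0) (dV _)).
- move=> s s0; rewrite mulrCA -mulrDr pmulr_rle0 ?expR_gt0// mulrC.
  by rewrite -lerBrDr sub0r -mulNr.
Qed.

End first_order.

(** * Growth of the objective around its minimiser *)

Section objective.
Context {R : realType} {d : nat} (Gamma : 'rV[R]_d -> R) (L : R) (xo : 'rV[R]_d).
Implicit Types x u v : 'rV[R]_d.
Local Notation G := (grad Gamma).
Local Notation H := (hessian Gamma).
Local Notation D := (d.+1%:R : R).
Hypothesis L1 : 1 <= L.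
Hypothesis dGamma : forall x, differentiable Gamma x.
Hypothesis dG : forall x, differentiable G x.
Hypothesis GL : forall x y, `|G x - G y| <= L * `|x - y|.
Hypothesis HL : forall x y, `|H x - H y| <= L * `|x - y|.
Hypothesis Gxo : forall x, G x = 0 <-> x = xo.
Hypothesis Hpos : posdef (H xo).

Let L0 : 0 <= L. Proof. exact: le_trans L1. Qed.
Let D0 : 0 < D. Proof. by []. Qed.

Lemma hessian_expanding : exists2 c : R, 0 < c & forall v, c * `|v| <= `|v *m H xo|.
Proof.
have [l l0 lH] := posdef_coercive Hpos; exists (l / D); first by rewrite divr_gt0.
move=> v; have [->|v0] := eqVneq v 0; first by rewrite normr0 mulr0.
have v1 : 0 < `|v| by rewrite normr_gt0.
rewrite mulrAC ler_pdivrMr// -(ler_pM2r v1) -mulrA -expr2 (le_trans (lH v))//.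
by rewrite (le_trans (ler_norm _))// (le_trans (dotp_le _ _))// mulrCA mulrA.
Qed.

Lemma grad_coercive_near : exists c r : R, [/\ 0 < c, 0 < r &
  forall v, `|v| <= r -> c * `|v| <= `|G (xo + v)|].
Proof.
have [c c0 cH] := hessian_expanding.
have DL0 : 0 < D * L by rewrite mulr_gt0// (lt_le_trans ltr01).
(* On this radius the linearisation error [D * L * |v|^2] uses up at most half of the expansion
   [c * |v|] of the Hessian. *)
exists (c / 2), (c / 2 / (D * L)); split; rewrite ?divr_gt0// => v vr.
have Gxo0 : G xo = 0 by exact/Gxo.
have := grad_linearize L0 dG HL xo xo v.
rewrite Gxo0 subr0 subrr normr0 add0r (proj1 Hpos) => e.
have e2 : D * L * (`|v| * `|v|) <= c / 2 * `|v|.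
  by rewrite mulrA ler_wpM2r// mulrC -ler_pdivlMr.
have h := cH v; have := lerB_dist (v *m H xo) (G (xo + v)).
rewrite distrC => t; lra.
Qed.

Lemma grad_coercive_far (delta : R) : 0 < delta ->
  (forall x, delta^-1 <= enorm x -> delta * enorm x <= enorm (G x)) ->
  exists c r : R, [/\ 0 < c, 0 < r &
  forall v, r <= `|v| -> c * `|v| <= `|G (xo + v)|].
Proof.
move=> de0 far; have id0 : 0 < delta^-1 by rewrite invr_gt0.
(* Beyond this radius [|xo + v|] is at least both [|v| / 2] and [delta^-1]. The division by [D]
   converts the Euclidean norm of the gradient into the sup norm. *)
exists (delta / D / 2), (2 * (`|xo| + delta^-1)); split.
- by rewrite !divr_gt0.
- by rewrite mulr_gt0// ltr_wpDl.
move=> v rv.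
have vx : `|v| <= `|xo + v| + `|xo|.
  by have := ler_normB (xo + v) xo; rewrite addrAC subrr add0r.
have e1 := le_enorm (xo + v).
have e2 := enorm_le (G (xo + v)).
have n0 := normr_ge0 xo.
have n1 : `|v| / 2 <= `|xo + v| by lra.
have /far e3 : delta^-1 <= enorm (xo + v) by lra.
have -> : delta / D / 2 * `|v| = delta * (`|v| / 2) / D by ring.
rewrite ler_pdivrMr// (mulrC _ D).
apply: le_trans e2; apply: le_trans e3; rewrite ler_wpM2l ?ltW//; lra.
Qed.

(** Three regions: near [xo] the Hessian gives the bound, far away the coercivity at infinity does,
    and on the compact shell between them [|G|] has a positive minimum because [G] vanishes only at
    [xo]. *)
Lemma grad_coercive (delta : R) : 0 < delta ->
  (forall x, delta^-1 <= enorm x -> delta * enorm x <= enorm (G x)) ->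
  exists2 c : R, 0 < c & forall x, c * `|x - xo| <= `|G x|.
Proof.
move=> de0 far.
have [c1 [r1 [c10 r10 h1]]] := grad_coercive_near.
have [c2 [r2 [c20 r20 h2]]] := grad_coercive_far de0 far.
have [c3 c30 h3] : exists2 c : R, 0 < c &
    forall x, r1 <= `|x - xo| <= r2 -> c * `|x - xo| <= `|G x|.
  have [K0|/set0P K0] := eqVneq [set x | r1 <= `|x - xo| <= r2] set0.
    exists 1 => // x xK; suff : [set x | r1 <= `|x - xo| <= r2] x by rewrite K0.
    exact: xK.
  have cG : continuous (fun x => `|G x|).
    move=> x; apply: (continuous_comp (differentiable_continuous (dG x))).
    exact: norm_continuous.
  have [x0 + xmin] := @EVT_min_rV R d _ _ K0 (@sphere_compact _ _ r1 r2 xo)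
    (continuous_subspaceT cG).
  rewrite inE /= => /andP[r1x _].
  exists (`|G x0| / r2).
    rewrite divr_gt0// normr_gt0; apply/eqP => /Gxo x0o.
    by move: r1x; rewrite x0o subrr normr0 leNgt r10.
  move=> x xK; have /xmin : x \in [set x | r1 <= `|x - xo| <= r2] by rewrite inE.
  apply: le_trans; rewrite mulrAC ler_pdivrMr// ler_wpM2l//.
  by case/andP: xK.
exists (Num.min c1 (Num.min c2 c3)); first by rewrite !lt_min c10 c20.
move=> x; have xv : x = xo + (x - xo) by rewrite addrC subrK.
have [xr1|/ltW xr1] := leP `|x - xo| r1.
  rewrite [in leRHS]xv (le_trans _ (h1 _ xr1))// ler_wpM2r//.
  by rewrite ge_min lexx.
have [xr2|/ltW xr2] := leP `|x - xo| r2.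
  rewrite (le_trans _ (h3 _ _)) ?xr1// ler_wpM2r//.
  by rewrite !ge_min lexx !orbT.
rewrite [in leRHS]xv (le_trans _ (h2 _ xr2))// ler_wpM2r//.
by rewrite !ge_min lexx !orbT.
Qed.

(* Along the gradient flow [Gamma - k |x - xo|^2] decreases and tends to
   [Gamma xo]; this is where global stability of the flow is used. *)
Lemma quadratic_growth (c : R) : 0 < c -> (forall x, c * `|x - xo| <= `|G x|) ->
  exp_stable (fun x => - G x) xo ->
  exists2 k : R, 0 < k & forall v, k * `|v| ^+ 2 <= Gamma (xo + v) - Gamma xo.
Proof.
move=> c0 cG [sol [b [rate [rate0 stab]]]].
(* With this [k] the term [2 k <x - xo, G x>] in the derivative of [V] along the flow is at most
   [c |x - xo| |G x|], hence at most [|G x|^2]. *)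
have [k k0 kE] : exists2 k : R, 0 < k & k * (2 * D) = c.
  exists (c / (2 * D)); first by rewrite divr_gt0// mulr_gt0.
  by rewrite divfK// mulf_neq0// ?pnatr_eq0.
exists k => // v.
have [y yF y0] := sol (xo + v).
pose V x := Gamma x - k * dotp (x - xo) (x - xo).
have Vquad x u : `|V (x + u) - V x - dotp (G x - k *: (2 *: (x - xo))) u| <=
    (D * L + k * D) * `|u| ^+ 2.
  have := taylor1 x u dGamma GL; have := dotp_le u u.
  rewrite -(sqr_dotp_expand x u xo) /V (dotpBl (G x)) (dotpZl k) -(ler_pM2l k0).
  have -> (q q' g g' l m : R) : g' - k * q' - (g - k * q) - (l - k * m) =
    g' - g - l - k * (q' - q - m) by ring.
  rewrite -[X in X * `|_| <= _](gtr0_norm k0) -normrM => h1 h2.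
  apply: le_trans (ler_normB _ _) _; rewrite mulrDl lerD// (le_trans h1)//.
  by rewrite -expr2 mulrA.
have dV x : differentiable V x by have [] := diff_quadratic_error (Vquad x).
have VF x : 'd V x (- G x) <= - 0 * V x.
  have -> : 'd V x (- G x) = - dotp (G x) (G x) + k * (2 * dotp (x - xo) (G x)).
    rewrite (proj2 (diff_quadratic_error (Vquad x))) (dotpBl (G x)) 2!dotpZl !dotpNr.
    by ring.
  rewrite oppr0 mul0r addrC subr_le0.
  apply: le_trans (dotp_ge (G x)).
  have h1 := le_trans (ler_norm _) (dotp_le (x - xo) (G x)).
  apply: le_trans (_ : k * (2 * (D * (`|x - xo| * `|G x|))) <= _).
    by apply: ler_wpM2l; [exact: ltW|exact: ler_wpM2l].
  have -> : k * (2 * (D * (`|x - xo| * `|G x|))) = c * `|x - xo| * `|G x|.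
    by rewrite -kE; ring.
  by rewrite expr2 ler_wpM2r.
have Vy t : 0 <= t -> V (y t) <= V (xo + v).
  by move=> /(lyapunov_decay dV VF yF); rewrite mul0r oppr0 expR0 mul1r y0.
(* The gradient vanishes at [xo], so [V] falls below [Gamma xo] by at most a multiple of the squared
   distance; along the flow this distance tends to 0. *)
have Vlow u : - ((D * L + k * D) * `|u| ^+ 2) <= V (xo + u) - Gamma xo.
  have := taylor1 xo u dGamma GL.
  rewrite (iffRL (Gxo _) erefl) dotpC dotp0r subr0 ler_norml => /andP[+ _].
  have := le_trans (ler_norm _) (dotp_le u u).
  rewrite /V (addrAC xo) subrr add0r -expr2 -(ler_pM2l k0).
  rewrite mulrDl -(mulrA k); lra.
suff : Gamma xo <= V (xo + v).
  rewrite /V (addrAC xo) subrr add0r => h.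
  have := dotp_ge v; rewrite -(ler_pM2l k0); lra.
rewrite -subr_ge0; apply/ler_addgt0Pr => e e0.
pose B := (D * L + k * D) * (`|b| * enorm v) ^+ 2.
have C0 : 0 <= D * L + k * D.
  by rewrite addr_ge0// mulr_ge0// ltW.
have B0 : 0 <= B by rewrite mulr_ge0// sqr_ge0.
have [t t0 Bt] : exists2 t : R, 0 <= t & B * expR (- (rate * t)) <= e.
  (* For this time [expR (rate * t)] is [expR (B / e)], which exceeds [B / e] since
     [1 + x <= expR x]. *)
  exists (B / e / rate); first by rewrite !divr_ge0// ltW.
  have -> : rate * (B / e / rate) = B / e by rewrite mulrC divfK// gt_eqF.
  rewrite expRN ler_pdivrMr ?expR_gt0// -ler_pdivrMl// (mulrC e^-1).
  by rewrite (le_trans _ (expR_ge1Dx _))// lerDr.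
have := Vlow (y t - xo); rewrite [xo + _]addrC subrK => h.
have {}h := le_trans h (lerB (Vy t t0) (lexx _)).
have st : `|y t - xo| <= `|b| * enorm v * expR (- (rate * t)).
  apply: le_trans (le_enorm _) _; apply: le_trans (stab y yF t t0) _.
  rewrite y0 (addrAC xo) subrr add0r ler_wpM2r ?expR_ge0// ler_wpM2r ?sqrtr_ge0//.
  exact: ler_norm.
have st2 : `|y t - xo| ^+ 2 <= (`|b| * enorm v) ^+ 2 * expR (- (rate * t)).
  apply: le_trans (_ : (`|b| * enorm v * expR (- (rate * t))) ^+ 2 <= _).
    by rewrite lerXn2r ?nnegrE// mulr_ge0 ?expR_ge0// mulr_ge0// sqrtr_ge0.
  rewrite exprMn ler_wpM2l ?sqr_ge0// expr2 ler_piMl ?expR_ge0//.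
  by rewrite -expR0 ler_expR oppr_le0 mulr_ge0// ltW.
rewrite -lerBlDr sub0r (le_trans _ h)// lerN2 (le_trans _ Bt)//.
by rewrite (le_trans (ler_wpM2l C0 st2))// mulrA.
Qed.

End objective.

(** * Global solutions of Lipschitz differential equations *)

Section picard.
Context {R : realType} {d : nat}.
Implicit Types (F : 'rV[R]_d -> 'rV[R]_d) (y z : R -> 'rV[R]_d).

Lemma is_derive_rV y (t : R) (v : 'rV[R]_d) :
  (forall i, is_derive t 1 (fun s => y s 0 i) (v 0 i)) -> is_derive t 1 y v.
Proof.
move=> h; have dy : derivable y t 1.
  by apply/derivable_mxP => j i; rewrite ord1; have [] := h i.
apply: DeriveDef => //; rewrite derive_mx//; apply/matrixP => j i.
by rewrite mxE !ord1; have [] := h i.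
Qed.

Lemma is_derive_entry y (t : R) (v : 'rV[R]_d) i :
  is_derive t 1 y v -> is_derive t 1 (fun s => y s 0 i) (v 0 i).
Proof.
move=> [dy <-]; apply: DeriveDef; first by move/derivable_mxP : dy; apply.
by rewrite derive_mx// mxE.
Qed.

(* The integral starts at [-1] so that [0] is an interior point. *)
Definition primitive (g : R -> R) (t : R) : R :=
  \int[lebesgue_measure]_(s in `[-1, t]) g s -
  \int[lebesgue_measure]_(s in `[-1, 0]) g s.

Lemma is_derive_primitive g (t : R) : continuous g -> -1 < t ->
  is_derive t 1 (primitive g) (g t).
Proof.
move=> cg t1; have tt : t < t + 1 by rewrite ltrDl.
have gi : lebesgue_measure.-integrable `[-1, t + 1] (EFin \o g).
  apply: continuous_compact_integrable; first exact: segment_compact.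
  exact: continuous_subspaceT.
have [dp pE] := continuous_FTC1_closed tt gi t1 (cg t).
have d1 : is_derive t 1 (fun x => \int[lebesgue_measure]_(s in `[-1, x]) g s) (g t).
  by apply: DeriveDef => //; rewrite -derive1E.
by rewrite -[g t]subr0; apply: is_deriveB.
Qed.

Definition picard F (x0 : 'rV[R]_d) y (t : R) : 'rV[R]_d :=
  \row_i (x0 0 i + primitive (fun s => F (y `|s|) 0 i) t).

Lemma picard0 F x0 y : picard F x0 y 0 = x0.
Proof. by apply/rowP => i; rewrite mxE /primitive subrr addr0. Qed.

Lemma is_derive_picard F x0 y (t : R) : continuous F -> continuous y ->
  -1 < t -> is_derive t 1 (picard F x0 y) (F (y `|t|)).
Proof.
move=> cF cy t1; apply: is_derive_rV => i.
rewrite (_ : (fun s => _) = cst (x0 0 i) + primitive (fun s => F (y `|s|) 0 i)).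
  rewrite -[F _ 0 i]add0r; apply: is_deriveD.
  apply: (is_derive_primitive (g := fun s => F (y `|s|) 0 i)) => //.
  move=> s; apply: (continuous_comp (f := fun s : R => F (y `|s|))
    (g := fun v : 'rV[R]_d => v 0 i)); last exact: coord_continuous.
  apply: (continuous_comp (f := fun s : R => y `|s|)); last exact: cF.
  by apply: continuous_comp; [exact: norm_continuous|exact: cy].
by apply/funext => s; rewrite !fctE/= mxE.
Qed.

Lemma continuous_abs_picard F x0 y : continuous F -> continuous y ->
  continuous (fun t : R => picard F x0 y `|t|).
Proof.
move=> cF cy t; apply: continuous_comp; first exact: norm_continuous.
have t1 : -1 < `|t| by rewrite (lt_le_trans _ (normr_ge0 t))// oppr_lt0.
have [dp _] := is_derive_picard x0 cF cy t1.
exact/differentiable_continuous/derivable1_diffP.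
Qed.

(** The sup norm is not differentiable, so monotonicity is applied to [e * y_i - a * expR (M * t)]
    for each coordinate and each sign [e]. *)
Lemma exp_growth_bound y dy (a M : R) : 0 <= a ->
  (forall t : R, -1 < t -> is_derive t 1 y (dy t)) -> `|y 0| <= a ->
  (forall t : R, 0 < t -> `|dy t| <= a * (M * expR (M * t))) ->
  forall t, 0 <= t -> `|y t| <= a * expR (M * t).
Proof.
move=> a0 ddy y0 dyb t t0; apply: rVnorm_le => [|i].
  by rewrite mulr_ge0// expR_ge0.
have dm (s : R) : is_derive s 1 (fun s => M * s) M.
  by rewrite -[X in is_derive _ _ _ X]mulr1; exact: is_deriveZ.
have de (s : R) := is_deriveZ a (is_derive1_comp (is_derive_expR (M * s)) (dm s)).
have bound (e : R) : `|e| = 1 -> e * y t 0 i <= a * expR (M * t).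
  move=> e1.
  have dphi (s : R) : -1 < s -> is_derive s 1
      ((e *: fun s => y s 0 i) - (a *: (expR \o ( *%R M)) : R -> R))
      (e * dy s 0 i - a * (expR (M * s) * M)).
    by move=> s1; apply: is_deriveB; apply: is_deriveZ; exact/is_derive_entry/ddy.
  have := nonincreasing_within _ (fun s s0 => dphi s (lt_trans (ltrN10 R) s0)) _ t0.
  move=> H; have : e * y t 0 i - a * expR (M * t) <= e * y 0 0 i - a * expR (M * 0).
    apply: H.
      apply: continuous_in_subspaceT => s; rewrite inE/= in_itv/= andbT => s0.
      have [ds _] := dphi s (lt_le_trans (ltrN10 R) s0).
      exact/differentiable_continuous/derivable1_diffP.
    move=> s s0; rewrite subr_le0 (mulrC (expR _)).
    apply: le_trans (dyb s s0); apply: le_trans (ler_norm _) _.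
    by rewrite normrM e1 mul1r entry_le.
  move=> h; rewrite -subr_le0 (le_trans h)// mulr0 expR0 mulr1 subr_le0.
  apply: le_trans y0; apply: le_trans (ler_norm _) _.
  by rewrite normrM e1 mul1r entry_le.
rewrite ler_norml; apply/andP; split.
  have := bound (-1); rewrite normrN normr1 mulN1r => /(_ erefl).
  by rewrite lerNl.
by have := bound 1; rewrite normr1 mul1r; apply.
Qed.

End picard.

Section ode_existence.
Context {R : realType} {d : nat}.
Implicit Types (F : 'rV[R]_d -> 'rV[R]_d) (y z : R -> 'rV[R]_d).

Lemma pow2_small (C e : R) : 0 < e -> exists n0, forall n, (n0 <= n)%N ->
  C / 2 ^+ n <= e.
Proof.
move=> e0; have C0 : 0 <= `|C| / e by rewrite divr_ge0// ltW.
exists (Num.bound (`|C| / e)) => n n0n.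
have p0 : 0 < 2 ^+ n :> R by rewrite exprn_gt0.
rewrite ler_pdivrMr// -ler_pdivrMl// mulrC.
apply: le_trans (_ : `|C| / e <= _).
  by rewrite ler_wpM2r ?invr_ge0 ?(ltW e0)// ler_norm.
apply: ltW; apply: lt_le_trans (archi_boundP C0) _.
by rewrite -natrX ler_nat (leq_trans n0n)// ltnW// ltn_expl.
Qed.

Lemma geometric_limit (X : completeNormedModType R) (u : nat -> X) (C : R) :
  (forall n, `|u n.+1 - u n| <= C / 2 ^+ n) ->
  exists l, forall n, `|u n - l| <= 2 * C / 2 ^+ n.
Proof.
move=> uC; have C0 : 0 <= C.
  by have := le_trans (normr_ge0 _) (uC 0%N); rewrite expr0 divr1.
pose v := telescope u.
have uE : forall n, u n = u 0%N + series v n := eq_sum_telescope u.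
have cv : cvgn (series v).
  apply: normed_cvg; apply: (@series_le_cvg _ _ (geometric C 2^-1)).
  - by move=> n /=; exact: normr_ge0.
  - by move=> n /=; rewrite mulr_ge0// exprn_ge0// invr_ge0.
  - by move=> n /=; rewrite exprVn; exact: uC.
  - by apply: is_cvg_geometric_series; rewrite ger0_norm ?invr_ge0// invf_lt1// ltr1n.
have step n m : `|u n - u (n + m)%N| <= 2 * C / 2 ^+ n * (1 - 2^-1 ^+ m).
  elim: m => [|m IH]; first by rewrite addn0 subrr normr0 expr0 subrr mulr0.
  rewrite (le_trans (ler_distD (u (n + m)%N) _ _))//.
  rewrite (le_trans (lerD IH (_ : _ <= C / 2 ^+ (n + m))))//.
    by rewrite distrC addnS.
  rewrite le_eqVlt; apply/orP; left; apply/eqP.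
  rewrite exprS exprD exprVn; field.
  by rewrite !expf_neq0//= pnatr_eq0.
exists (u 0%N + limn (series v)) => n; apply/ler_addgt0Pr => e e0.
have /cvgrPdist_le /(_ e e0) [N _ hN] := cv.
have := hN (maxn n N) (leq_maxr _ _) => /= h.
rewrite (le_trans (ler_distD (u (maxn n N)) _ _))// lerD//.
  rewrite -(subnKC (leq_maxl n N)) (le_trans (step _ _))//.
  rewrite ler_piMr ?gerBl ?exprn_ge0 ?invr_ge0// !mulr_ge0// invr_ge0 exprn_ge0//.
by rewrite uE opprD addrACA subrr add0r distrC.
Qed.

Lemma geometric_limit_rV (u : nat -> 'rV[R]_d) (C : R) :
  (forall n, `|u n.+1 - u n| <= C / 2 ^+ n) ->
  exists l, forall n, `|u n - l| <= 2 * C / 2 ^+ n.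
Proof.
move=> uC; have C0 : 0 <= C.
  by have := le_trans (normr_ge0 _) (uC 0%N); rewrite expr0 divr1.
have h i : exists l, forall n, `|u n 0 i - l| <= 2 * C / 2 ^+ n.
  apply: geometric_limit => n; apply: le_trans (uC n).
  by apply: le_trans (entry_le _ 0 i); rewrite !mxE.
have [l hl] := choice h; exists (\row_i l i) => n.
apply: rVnorm_le => [|i]; first by rewrite divr_ge0 ?exprn_ge0// mulr_ge0.
by rewrite !mxE.
Qed.

Lemma lipschitz_continuous (V W : normedModType R) (f : V -> W) (K : R) :
  0 < K -> (forall u v, `|f u - f v| <= K * `|u - v|) -> continuous f.
Proof.
move=> K0 fK x; apply/cvgrPdist_le => e e0; apply/nbhs_ballP.
exists (e / K) => [|v] /=; first by rewrite divr_gt0.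
rewrite -ball_normE/= => /ltW xv; rewrite (le_trans (fK _ _))//.
by rewrite mulrC -ler_pdivlMr.
Qed.

(** In the norm weighted by [expR (- (M * t))] with [M = 2 * K] the Picard operator contracts by 1/2
    on the whole half-line, so no local solutions have to be glued. *)
Theorem picard_lindelof F (K : R) (x0 : 'rV[R]_d) : 0 < K ->
  (forall u v : 'rV[R]_d, `|F u - F v| <= K * `|u - v|) ->
  exists2 x, ode_solution F x & x 0 = x0.
Proof.
move=> K0 FK.
have cF : continuous F. exact: lipschitz_continuous FK.
pose M := 2 * K; have M0 : 0 < M by rewrite mulr_gt0.
have contr y z a : continuous y -> continuous z -> 0 <= a ->
    (forall t : R, `|y `|t| - z `|t| | <= a * expR (M * `|t|)) ->
    forall t, 0 <= t ->
    `|picard F x0 y t - picard F x0 z t| <= a / 2 * expR (M * t).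
  move=> cy cz a0 yz.
  apply: (@exp_growth_bound _ _ (picard F x0 y - picard F x0 z)
    (fun t => F (y `|t|) - F (z `|t|)) (a / 2) M); first by rewrite divr_ge0.
  - by move=> t t1; apply: is_deriveB; exact: is_derive_picard.
  - rewrite (_ : (_ - _) 0 = picard F x0 y 0 - picard F x0 z 0)// !picard0.
    by rewrite subrr normr0 divr_ge0.
  - move=> t t0; apply: le_trans (FK _ _) _.
    have -> : a / 2 * (M * expR (M * t)) = K * (a * expR (M * t)).
      by rewrite /M; field.
    by rewrite ler_wpM2l ?(ltW K0)// -[in leRHS](gtr0_norm t0).
pose u := fix u n : R -> 'rV[R]_d := if n is n'.+1
  then (fun t => picard F x0 (u n') `|t|) else (fun=> x0).
have cu n : continuous (u n).
  elim: n => [|n IH]; first exact: cst_continuous.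
  exact: continuous_abs_picard.
have abs_u n t : u n `|t| = u n t by case: n => //= n; rewrite normr_id.
(* The weighted size of the first displacement: [a * M = |F x0|] is its speed. *)
pose a := `|F x0| / M; have a0 : 0 <= a by rewrite divr_ge0// ltW.
have du n t : `|u n.+1 t - u n t| <= a / 2 ^+ n * expR (M * `|t|).
  elim: n t => [|n IH] t.
    rewrite expr0 divr1 /=.
    apply: (@exp_growth_bound _ _ (picard F x0 (fun=> x0) - cst x0)
      (fun t => F x0 - 0) a M) => //.
    - move=> s s1; apply: is_deriveB.
      exact: (is_derive_picard x0 cF (@cst_continuous _ _ x0)).
    - rewrite (_ : (_ - _) 0 = picard F x0 (fun=> x0) 0 - x0)// picard0.
      by rewrite subrr normr0.
    - move=> s s0; rewrite subr0 /a mulrA divfK ?gt_eqF// ler_peMr//.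
      by rewrite -expR0 ler_expR mulr_ge0// ltW.
  have -> : a / 2 ^+ n.+1 = a / 2 ^+ n / 2 by rewrite exprSr invfM mulrA.
  apply: (contr (u n.+1) (u n)) => //; first by rewrite divr_ge0// exprn_ge0.
  by move=> s; have := IH `|s|; rewrite normr_id.
have lim_u t : exists l, forall n, `|u n t - l| <=
    2 * (a * expR (M * `|t|)) / 2 ^+ n.
  by apply: geometric_limit_rV => n; rewrite mulrAC.
have [x xl] := choice lim_u.
have cx : continuous x.
  move=> t; apply/cvgrPdist_le => /= e e0.
  have e3 : 0 < e / 3 by rewrite divr_gt0.
  have [n hn] := pow2_small (2 * (a * expR (M * (`|t| + 1)))) e3.
  have xn s : `|s| <= `|t| + 1 -> `|u n s - x s| <= e / 3.
    move=> st; rewrite (le_trans (xl s n))// (le_trans _ (hn n (leqnn n)))//.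
    rewrite ler_wpM2r ?invr_ge0 ?exprn_ge0// ler_wpM2l// ler_wpM2l// ler_expR.
    by rewrite ler_wpM2l// ltW.
  near=> s.
  have st : `|s| <= `|t| + 1.
    have ts : `|t - s| <= 1.
      near: s; apply/nbhs_ballP; exists 1 => //=.
      by move=> s /= /ltW.
    rewrite -[s](subKr t) (le_trans (ler_normB _ _))//.
    by rewrite lerD2l.
  have uts : `|u n t - u n s| <= e / 3.
    by near: s; move/cvgrPdist_le : (cu n t) => /(_ _ e3).
  have xt : `|u n t - x t| <= e / 3 by apply: xn; rewrite lerDl.
  have xs := xn s st.
  have -> : x t - x s = - (u n t - x t) + ((u n t - u n s) + (u n s - x s)).
    by apply/rowP => i; rewrite !mxE; ring.
  rewrite (le_trans (ler_normD _ _))// normrN.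
  have := ler_normD (u n t - u n s) (u n s - x s); lra.
have xE t : 0 <= t -> x t = picard F x0 x t.
  move=> t0; apply/eqP; rewrite -subr_eq0 -normr_le0.
  apply/ler_addgt0Pr => e e0; rewrite add0r.
  have e3 : 0 < e / 2 by rewrite divr_gt0.
  have [n hn] := pow2_small (2 * (a * expR (M * `|t|))) e3.
  have h1 := le_trans (xl t n.+1) (hn n.+1 (leqnSn n)).
  have h2 : `|u n.+1 t - picard F x0 x t| <= e / 2.
    rewrite /= (ger0_norm t0).
    apply: le_trans (@contr (u n) x (2 * a / 2 ^+ n) _ _ _ _ t t0) _ => //.
    - by rewrite divr_ge0// ?exprn_ge0// mulr_ge0.
    - move=> s; apply: le_trans (xl `|s| n) _.
      by rewrite normr_id; rewrite mulrA mulrAC.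
    - apply: le_trans (hn n (leqnn n)).
      rewrite (ger0_norm t0) (_ : 2 * a / 2 ^+ n / 2 = a / 2 ^+ n).
        rewrite mulrAC ler_wpM2r ?invr_ge0 ?exprn_ge0// ler_peMl ?ler1n//.
        by rewrite mulr_ge0// expR_ge0.
      by field; rewrite ?expf_neq0// pnatr_eq0.
  rewrite -(subrKA (u n.+1 t)) (le_trans (ler_normD _ _))// distrC.
  lra.
(* The Picard image is taken instead of the limit [x]: the two agree for nonnegative times, and the
   image is differentiable on an open interval around the half-line. *)
exists (picard F x0 x); last exact: picard0.
have dX (t : R) : -1 < t -> is_derive t 1 (picard F x0 x) (F (x `|t|)).
  exact: is_derive_picard.
split.
  apply: continuous_in_subspaceT => t; rewrite inE/= in_itv/= andbT => t0.
  have [dt _] := dX t (lt_le_trans (ltrN10 R) t0).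
  exact/differentiable_continuous/derivable1_diffP.
move=> t t0; have := dX t (lt_trans (ltrN10 R) t0).
by rewrite (gtr0_norm t0) xE ?ltW// xE ?ltW//.
Unshelve. all: by end_near. Qed.

End ode_existence.

(** * Law of the exploration noise *)

Section projections.
Context {R : realType} {T U : topologicalType}.

Lemma continuous_comp_fst (f : T -> R) :
  continuous f -> continuous (f \o fst : T * U -> R).
Proof. by move=> cf x; apply: continuous_comp; [exact: cvg_fst|exact: cf]. Qed.

Lemma continuous_comp_snd (f : U -> R) :
  continuous f -> continuous (f \o snd : T * U -> R).
Proof. by move=> cf x; apply: continuous_comp; [exact: cvg_snd|exact: cf]. Qed.

End projections.

(** * Finite nets of a compact set *)

Section discretization.
Context {R : realType} {d : nat}.
Implicit Types (x y a : 'rV[R]_d) (s : seq 'rV[R]_d) (r : R).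

Lemma compact_net (K : set 'rV[R]_d) r : compact K -> 0 < r ->
  exists s, {in s, forall a, K a} /\ forall x, K x -> has (fun a => `|x - a| < r) s.
Proof.
move=> cK r0; rewrite compact_cover in cK.
have oB a : K a -> open (ball a r) by move=> _; exact: ball_open.
have covK : K `<=` cover K (fun a => ball a r).
  by move=> x Kx; exists x => //; exact: ballxx.
have [A AK KA] := cK _ _ _ oB covK.
exists (finmap.enum_fset A); split; first by move=> a /AK; rewrite inE.
move=> x /KA [a aA axr]; apply/hasP; exists a => //.
by move: axr; rewrite -ball_normE/= distrC.
Qed.

(** Taking the first point within distance [r] makes the cells disjoint and Borel, each being a ball
    minus earlier balls. The value [size s] means that no point of the net is close. *)
Definition net_index s r x : nat := find (fun a => `|x - a| < r) s.

Definition net_point s r x : 'rV[R]_d := nth 0 s (net_index s r x).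

Lemma borel_net_index s r (j : nat) : borel_rV [set x | net_index s r x = j].
Proof.
rewrite -[borel_rV]/(@measurable _ (g_sigma_algebraType (@open 'rV[R]_d))).
have mball a : @measurable _ (g_sigma_algebraType (@open 'rV[R]_d))
    [set x | `|x - a| < r].
  apply: sub_sigma_algebra; have [r0|r0] := ltP 0 r.
    rewrite (_ : [set x | _] = ball a r); first exact: ball_open.
    by apply/seteqP; split => x /=; rewrite -ball_normE/= distrC.
  rewrite (_ : [set x | _] = set0); first exact: open0.
  by apply/seteqP; split => x //=; rewrite ltNge (le_trans r0).
elim: s j => [|a s IH] [|j] /=.
- by rewrite (_ : [set x | _] = setT)//; apply/seteqP; split.
- by rewrite (_ : [set x | _] = set0)//; apply/seteqP; split.
- rewrite (_ : [set x | _] = [set x | `|x - a| < r])//.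
  by apply/seteqP; split => x /=; rewrite /net_index/=; case: ifP.
- rewrite (_ : [set x | _] =
    ~` [set x | `|x - a| < r] `&` [set x | net_index s r x = j]).
    by apply: measurableI; [exact: measurableC|exact: IH].
  apply/seteqP; split => x /=; rewrite /net_index/=; case: ifP => // h.
    by move=> [->]; split => //; rewrite h.
  + by move=> [].
  + by move=> [_ ->].
Qed.

End discretization.

(** * Joint law of two distinct noise variables *)

Section independence.
Context {R : realType} {d : nat} {dO : measure_display}.
Context {Omega : measurableType dO} (P : probability Omega R).
Context (W : nat -> Omega -> 'rV[R]_d) (K : set 'rV[R]_d).
Hypothesis iidW : iid P W.
Hypothesis cK : compact K.
Hypothesis WK : forall n w, K (W n w).


Let rad (k : nat) : R := k.+1%:R^-1.
Let rad_gt0 k : 0 < rad k. Proof. by rewrite invr_gt0. Qed.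
Let net k := sval (cid (compact_net cK (rad_gt0 k))).
Let netK k : {in net k, forall a, K a}.
Proof. by rewrite /net; case: cid => s []. Qed.
Let net_has k x : K x -> has (fun a => `|x - a| < rad k) (net k).
Proof. by move: x; rewrite /net; case: cid => s []. Qed.
Let idx k x := net_index (net k) (rad k) x.
Let pt k x := net_point (net k) (rad k) x.
Let cell k (i : nat) := [set x | idx k x = i].
Let prob k (i : nat) : R := fine (P (W 0%N @^-1` cell k i)).

Let idx_lt k x : K x -> (idx k x < size (net k))%N.
Proof. by move=> /(net_has k); rewrite has_find. Qed.

Let ptK k x : K x -> K (pt k x).
Proof. by move=> Kx; apply: (@netK k); rewrite mem_nth// idx_lt. Qed.

Let pt_near k x : K x -> `|x - pt k x| < rad k.
Proof. by move=> Kx; have := nth_find 0 (net_has k Kx). Qed.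

Let cvg_pt x : K x -> pt k x @[k --> \oo] --> x.
Proof.
move=> Kx; apply/cvgrPdist_lt => e e0; near=> k.
rewrite (lt_trans (pt_near k Kx))//.
by near: k; exact: near_infty_natSinv_lt (PosNum e0).
Unshelve. all: by end_near. Qed.

Let measurable_cell n k i : measurable (W n @^-1` cell k i).
Proof. by have [rW _ _] := iidW; apply: rW; exact: borel_net_index. Qed.

Let prob_cell n k i : P (W n @^-1` cell k i) = (prob k i)%:E.
Proof.
have [_ _ ->] := iidW; last exact: borel_net_index.
by rewrite fineK// fin_num_measure//; exact: measurable_cell.
Qed.

Let prob_cellI n m k i j : n != m ->
  P (W n @^-1` cell k i `&` W m @^-1` cell k j) = (prob k i * prob k j)%:E.
Proof.
move=> nm; have [_ iW _] := iidW.
have := iW [:: n; m] (fun l => if l == n then cell k i else cell k j).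
rewrite /= inE nm big_cons big_cons big_nil mule1 eqxx eq_sym (negbTE nm).
rewrite !prob_cell EFinM => <- //; last first.
  by move=> l; case: ifP => _; exact: borel_net_index.
congr (P _); apply/seteqP; split => w /=.
  move=> [wn wm] l /=; rewrite !inE => /orP[] /eqP ->; rewrite ?eqxx//.
  by rewrite eq_sym (negbTE nm).
move=> h; split; first by have := h n; rewrite /= !inE eqxx; apply.
by have := h m; rewrite /= !inE eqxx orbT eq_sym (negbTE nm); apply.
Qed.

Let step (H : 'rV[R]_d * 'rV[R]_d -> R) n m k w : R :=
  H (pt k (W n w), pt k (W m w)).

Let coef (H : 'rV[R]_d * 'rV[R]_d -> R) k (i j : nat) : R :=
  H ((net k)`_i, (net k)`_j).

Let stepE H n m k w : step H n m k w =
  \sum_(ij : 'I_(size (net k)) * 'I_(size (net k))) coef H k ij.1 ij.2 *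
    \1_(W n @^-1` cell k ij.1 `&` W m @^-1` cell k ij.2) w.
Proof.
pose i := Ordinal (idx_lt k (WK n w)); pose j := Ordinal (idx_lt k (WK m w)).
rewrite (bigD1 (i, j))//= big1 ?addr0.
  by rewrite indicE mem_set// mulr1.
move=> [i' j'] /= ij; rewrite indicE memNset ?mulr0//= => -[ii jj].
by move/eqP : ij; apply; congr (_, _); apply: val_inj.
Qed.

Let measurable_term H n m k (ij : 'I_(size (net k)) * 'I_(size (net k))) :
  measurable_fun setT (fun w => coef H k ij.1 ij.2 *
    \1_(W n @^-1` cell k ij.1 `&` W m @^-1` cell k ij.2) w).
Proof.
apply: measurable_funM; first exact: measurable_cst.
by apply: measurable_indic; apply: measurableI; exact: measurable_cell.
Qed.

Let measurable_step H n m k : measurable_fun setT (step H n m k).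
Proof.
rewrite (_ : step H n m k = fun w =>
    \sum_(ij : 'I_(size (net k)) * 'I_(size (net k))) coef H k ij.1 ij.2 *
    \1_(W n @^-1` cell k ij.1 `&` W m @^-1` cell k ij.2) w).
  by apply: measurable_sum => ij; exact: measurable_term.
by apply/funext => w; exact: stepE.
Qed.

Let integral_step H n m k : n != m -> (\int[P]_w (step H n m k w)%:E)%E =
  (\sum_(i < size (net k)) \sum_(j < size (net k))
    H ((net k)`_i, (net k)`_j) * (prob k i * prob k j))%:E.
Proof.
move=> nm; rewrite pair_big/=.
under eq_integral do rewrite stepE -sumEFin.
have mI (ij : 'I_(size (net k)) * 'I_(size (net k))) :
    measurable (W n @^-1` cell k ij.1 `&` W m @^-1` cell k ij.2).
  by apply: measurableI; exact: measurable_cell.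
rewrite integral_sum//; last first.
  move=> ij; under eq_fun do rewrite EFinM.
  apply: integrableZl => //; exact: integrable_indic.
rewrite -sumEFin; apply: eq_bigr => ij _.
under eq_integral do rewrite EFinM.
rewrite integralZl//; last first.
  exact: integrable_indic.
rewrite EFinM; congr (_ * _)%E; rewrite integral_indic// setIT.
exact: prob_cellI.
Qed.

Lemma continuous_bounded_pair (H : 'rV[R]_d * 'rV[R]_d -> R) : continuous H ->
  exists B, forall x y, K x -> K y -> `|H (x, y)| <= B.
Proof.
move=> cH.
have : bounded_set [set H p | p in K `*` K].
  apply: compact_bounded; apply: continuous_compact.
    exact: continuous_subspaceT.
  exact: compact_setX.
move=> [B [_ hB]]; exists (B + 1) => x y Kx Ky.
by apply: (hB (B + 1)); [rewrite ltrDl|exists (x, y)].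
Qed.

(* [(W n, W m)] is the pointwise limit of pairs with values in finite nets of
   [K], whose law is a product that depends neither on [n] nor on [m]. *)
Lemma discretized_law : exists (N : nat -> nat) (a : nat -> nat -> 'rV[R]_d)
    (p : nat -> nat -> R), forall (H : 'rV[R]_d * 'rV[R]_d -> R) n m,
    continuous H -> n != m ->
  measurable_fun setT (fun w => H (W n w, W m w)) /\
  \sum_(i < N k) \sum_(j < N k) H (a k i, a k j) * (p k i * p k j)
    @[k --> \oo] --> \int[P]_w H (W n w, W m w).
Proof.
exists (fun k => size (net k)), (fun k i => (net k)`_i), prob => H n m cH nm.
have cvgH w : step H n m k w @[k --> \oo] --> H (W n w, W m w).
  have cp : (pt k (W n w), pt k (W m w)) @[k --> \oo] --> (W n w, W m w).
    exact: (cvg_pair (cvg_pt (WK n w)) (cvg_pt (WK m w))).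
  by move=> A /(cH (W n w, W m w)) /cp.
have mH : measurable_fun setT (fun w => H (W n w, W m w)).
  by apply: (@measurable_fun_cvg _ _ _ setT (step H n m)).
refine (conj mH _).
have [B hB] := continuous_bounded_pair cH.
have [] := @dominated_convergence _ _ _ P setT measurableT
  (fun k w => (step H n m k w)%:E) (fun w => (H (W n w, W m w))%:E) (EFin \o cst B).
- by move=> k; apply/measurable_EFinP; exact: measurable_step.
- exact/measurable_EFinP.
- by apply: aeW => w _; apply: cvg_EFin; [exact: nearW|exact: cvgH].
- exact: finite_measure_integrable_cst.
- by apply: aeW => w k _; rewrite /= lee_fin hB//; apply/ptK/WK.
move=> iH _; rewrite -(@fineK _ (\int[P]_w (H (W n w, W m w))%:E)%E).
  move=> /fine_cvg; apply: cvg_trans; apply: near_eq_cvg; near=> k.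
  by rewrite /= integral_step.
by apply: integrable_fin_num.
Unshelve. all: by end_near. Qed.

(** Both integrals are limits of one and the same sequence of finite sums, because the nets and
    weights are chosen before the indices. *)
Lemma expectation_pair (H : 'rV[R]_d * 'rV[R]_d -> R) n m n' m' :
  continuous H -> n != m -> n' != m' ->
  \int[P]_w H (W n w, W m w) = \int[P]_w H (W n' w, W m' w).
Proof.
move=> cH nm nm'; have [N [a [p h]]] := discretized_law.
by rewrite -(cvg_lim _ (h H n m cH nm).2)// -(cvg_lim _ (h H n' m' cH nm').2).
Qed.

Lemma measurable_pair (H : 'rV[R]_d * 'rV[R]_d -> R) n m :
  continuous H -> n != m -> measurable_fun setT (fun w => H (W n w, W m w)).
Proof.
by move=> cH nm; have [N [a [p h]]] := discretized_law; have [] := h H n m cH nm.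
Qed.

Lemma expectation_independent (g h : 'rV[R]_d -> R) n m :
  continuous g -> continuous h -> n != m ->
  \int[P]_w (g (W n w) * h (W m w)) =
  (\int[P]_w g (W n w)) * (\int[P]_w h (W m w)).
Proof.
move=> cg ch nm; have [N [a [p law]]] := discretized_law.
have cgh : continuous ((g \o fst) \* (h \o snd) : 'rV[R]_d * 'rV[R]_d -> R).
  by move=> x; apply: continuousM; [exact: continuous_comp_fst|exact: continuous_comp_snd].
have [_ Lgh] := law _ n m cgh nm.
have [_ Lg] := law _ n m (continuous_comp_fst cg) nm.
have [_ Lh] := law _ n m (continuous_comp_snd ch) nm.
(* The function 1 shows that the total mass, the square of the sum of the weights, tends to 1. The
   two marginal sums each carry one surplus factor equal to the sum of the weights, and this limit
   compensates for their product. *)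
have cc1 : continuous (cst 1 : 'rV[R]_d * 'rV[R]_d -> R).
  by move=> x; exact: cst_continuous.
have [_ L1] := law _ n m cc1 nm.
rewrite Rintegral_cst// mul1r in L1.
have P1 : fine (P setT) = 1 by rewrite probability_setT.
rewrite [fine _]P1 in L1.
have Lgh' := @cvgM _ _ _ eventually_filter _ _ _ _ Lg Lh.
have := @cvgM _ _ _ eventually_filter _ _ _ _ Lgh L1; rewrite mulr1 => Lgh1.
rewrite -(cvg_lim _ Lgh1)// -(cvg_lim _ Lgh')//; congr (lim (_ @ \oo)).
apply/funext => k /=.
have sums (F : nat -> nat -> R) (u v : nat -> R) :
    (forall i j, F i j = u i * v j) ->
    \sum_(i < N k) \sum_(j < N k) F i j = (\sum_(i < N k) u i) * (\sum_(j < N k) v j).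
  move=> FE; rewrite big_distrl/=; apply: eq_bigr => i _.
  by rewrite big_distrr/=; apply: eq_bigr => j _; exact: FE.
rewrite (sums (fun i j => g (a k i) * h (a k j) * (p k i * p k j))
  (fun i => g (a k i) * p k i) (fun j => h (a k j) * p k j)); last first.
  by move=> i j; rewrite mulrACA.
rewrite (sums (fun i j => 1 * (p k i * p k j)) (p k) (p k)); last first.
  by move=> i j; rewrite mul1r.
rewrite (sums (fun i j => g (a k i) * (p k i * p k j))
  (fun i => g (a k i) * p k i) (p k)); last first.
  by move=> i j; rewrite mulrA.
rewrite (sums (fun i j => h (a k j) * (p k i * p k j))
  (p k) (fun j => h (a k j) * p k j)); last first.
  by move=> i j; rewrite mulrCA.
by rewrite mulrACA [RHS]mulrACA; congr (_ * _); rewrite mulrC.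
Qed.


End independence.

(* Everything the deterministic part of the argument needs to know about the
   law of the exploration noise. *)
Record noise_functional {R : realType} {d : nat}
    (E : ('rV[R]_d -> R) -> R) (M : R) : Prop := NoiseFunctional {
  noise_ge0 : 0 <= M;
  noise_linear : forall k (f g : 'rV[R]_d -> R), continuous f -> continuous g ->
    E (fun x => k * f x + g x) = k * E f + E g;
  noise_le : forall (f : 'rV[R]_d -> R) (C : R), continuous f ->
    (forall x, `|x| <= M -> f x <= C) -> E f <= C;
  noise_mean0 : forall i, E (fun x => x 0 i) = 0;
  noise_posdef : posdef (\matrix_(i, j) E (fun x => x 0 i * x 0 j)) }.

Section exploration.
Context {R : realType} {d : nat} {dO : measure_display}.
Context {Omega : measurableType dO} (P : probability Omega R).
Implicit Types (W xi : nat -> Omega -> 'rV[R]_d) (K : set 'rV[R]_d).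

Lemma fine_expectation (X : Omega -> R) :
  fine (expectation P X) = \int[P]_w X w.
Proof. by rewrite unlock. Qed.

Lemma integrable_pair W K (H : 'rV[R]_d * 'rV[R]_d -> R) n m :
  iid P W -> compact K -> (forall n w, K (W n w)) -> continuous H -> n != m ->
  P.-integrable setT (EFin \o (fun w => H (W n w, W m w))).
Proof.
move=> iW cK WK cH nm; apply: measurable_bounded_integrable => //.
- exact: fin_num_fun_lty.
- exact: (measurable_pair iW cK WK).
have [B hB] := continuous_bounded_pair cK cH.
exists B; split; first exact: num_real.
by move=> r Br w _ /=; rewrite (le_trans (hB _ _ (WK n w) (WK m w)))// ltW.
Qed.

Lemma integrable_realB (f g : Omega -> R) :
  P.-integrable setT (EFin \o f) -> P.-integrable setT (EFin \o g) ->
  P.-integrable setT (EFin \o (fun w => f w - g w)).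
Proof. by move=> fi gi; apply: eq_integrable (integrableB measurableT fi gi). Qed.

Lemma integrable_realD (f g : Omega -> R) :
  P.-integrable setT (EFin \o f) -> P.-integrable setT (EFin \o g) ->
  P.-integrable setT (EFin \o (fun w => f w + g w)).
Proof. by move=> fi gi; apply: eq_integrable (integrableD measurableT fi gi). Qed.

(** Both exploration schemes are a continuous map [T] of two consecutive noise variables: the first
    projection, or the scaled difference. Evaluating at the pair [(W 1, W 0)] gives a functional [E]
    independent of [n]. *)
Lemma pair_noise_functional W xi K (T : 'rV[R]_d * 'rV[R]_d -> 'rV[R]_d) :
  iid P W -> compact K -> (forall n w, K (W n w)) -> continuous T ->
  (forall n, (1 <= n)%N -> forall w, xi n w = T (W n w, W n.-1 w)) ->
  (forall i, \int[P]_w (T (W 1%N w, W 0%N w) 0 i) = 0) ->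
  posdef (\matrix_(i, j)
    \int[P]_w (T (W 1%N w, W 0%N w) 0 i * T (W 1%N w, W 0%N w) 0 j)) ->
  exists E M, noise_functional E M /\
    forall n (h : 'rV[R]_d -> R), (1 <= n)%N -> continuous h ->
      fine (expectation P (fun w => h (xi n w))) = E h.
Proof.
move=> iW cK WK cT xiT mean0 cov.
have cHT (h : 'rV[R]_d -> R) : continuous h -> continuous (h \o T).
  by move=> ch p; apply: continuous_comp; [exact: cT|exact: ch].
have iHT (h : 'rV[R]_d -> R) : continuous h ->
    P.-integrable setT (EFin \o (fun w => h (T (W 1%N w, W 0%N w)))).
  by move=> ch; exact: (integrable_pair (H := h \o T) iW cK WK (cHT h ch)).
have cN : continuous (fun p => `|T p|).
  by move=> p; apply: (continuous_comp (cT p)); exact: norm_continuous.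
have [B hB] := continuous_bounded_pair cK cN.
exists (fun h => \int[P]_w h (T (W 1%N w, W 0%N w))), (Num.max 0 B); split.
  split => //.
  - by rewrite le_max lexx.
  - move=> k f g cf cg; rewrite RintegralD//.
    + by rewrite RintegralZl//; exact: iHT.
    + apply: (iHT (fun x => k * f x)) => x.
      by apply: continuousM; [exact: cst_continuous|exact: cf].
    + exact: iHT.
  - move=> f C cf fC.
    have -> : C = \int[P]_(w in setT) cst C w.
      rewrite Rintegral_cst//.
      have P1 : fine (P setT) = 1 by rewrite probability_setT.
      by rewrite [fine _]P1 mulr1.
    apply: le_Rintegral => //; first exact: iHT.
      exact: finite_measure_integrable_cst.
    move=> w _; apply: fC; rewrite le_max.
    by rewrite -[`|T _|]normr_id hB ?orbT.
move=> n h n1 ch; rewrite fine_expectation.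
have -> : (fun w => h (xi n w)) = fun w => (h \o T) (W n w, W n.-1 w).
  by apply/funext => w; rewrite /= xiT.
apply: (expectation_pair iW cK WK (cHT h ch)) => //.
(* At [n = 0] the predecessor would be [0] again; [1 <= n] makes the two indices distinct. *)
by rewrite gtn_eqF// prednK.
Qed.

Lemma posdefD (S S' : 'M[R]_d) : posdef S -> posdef S' -> posdef (S + S').
Proof.
move=> [tS pS] [tS' pS']; split; first by rewrite linearD/= tS tS'.
by move=> v v0; rewrite mulmxDr mulmxDl mxE addr_gt0// ?pS ?pS'.
Qed.

Lemma posdefZ (c : R) (S : 'M[R]_d) : 0 < c -> posdef S -> posdef (c *: S).
Proof.
move=> c0 [tS pS]; split; first by rewrite linearZ/= tS.
by move=> v v0; rewrite -scalemxAr -scalemxAl mxE mulr_gt0// pS.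
Qed.

Lemma exploration_noise_functional W xi : exploration_sequence P W xi ->
  exists E M, noise_functional E M /\
    forall n (h : 'rV[R]_d -> R), (1 <= n)%N -> continuous h ->
      fine (expectation P (fun w => h (xi n w))) = E h.
Proof.
move=> [[iW [K cK WK] meanW _ covW] xiE].
have mean0 n i : \int[P]_w (W n w 0 i) = 0.
  by rewrite -fine_expectation meanW.
have cE i : continuous (fun x : 'rV[R]_d => x 0 i : R).
  by move=> x; exact: coord_continuous.
case: xiE => [xiW|[c c0 xiW]].
  apply: (@pair_noise_functional W xi K fst) => //.
  - by move=> x; exact: cvg_fst.
  - by move=> n n1 w; rewrite xiW.
  - by move=> i; exact: mean0.
  - rewrite (_ : \matrix_(i, j) _ = second_moment P (W 1%N))//.
    by apply/matrixP => i j; rewrite !mxE fine_expectation.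
pose T (p : 'rV[R]_d * 'rV[R]_d) := c *: (p.1 - p.2).
have c1 := @continuous_comp_fst R 'rV[R]_d 'rV[R]_d.
have c2 := @continuous_comp_snd R 'rV[R]_d 'rV[R]_d.
have TE p i : T p 0 i = c * (p.1 0 i - p.2 0 i) by rewrite !mxE.
apply: (@pair_noise_functional W xi K T) => //.
- move=> p; apply: rV_continuous => i.
  have -> : (fun s => T s 0 i) = (cst c : 'rV[R]_d * 'rV[R]_d -> R) \*
      (((fun x : 'rV[R]_d => x 0 i) \o fst) \- ((fun x : 'rV[R]_d => x 0 i) \o snd)).
    by apply/funext => s; rewrite TE.
  apply: continuousM; first exact: cst_continuous.
  by apply: continuousB; [exact: (c1 _ (cE i))|exact: (c2 _ (cE i))].
- by move=> n n1 w; rewrite xiW.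
- move=> i; under eq_Rintegral do rewrite TE.
  have i1 := integrable_pair iW cK WK (c1 _ (cE i)) (isT : 1%N != 0%N).
  have i0 := integrable_pair iW cK WK (c2 _ (cE i)) (isT : 1%N != 0%N).
  rewrite RintegralZl//; last exact: (integrable_realB i1 i0).
  by rewrite RintegralB//= !mean0 subrr mulr0.
(* In the covariance of the difference the cross terms vanish by independence and zero mean, leaving
   a positive multiple of a sum of two positive definite matrices. *)
rewrite (_ : \matrix_(i, j) _ =
    c ^+ 2 *: (second_moment P (W 1%N) + second_moment P (W 0%N))).
  by apply: posdefZ; [rewrite exprn_gt0|apply: posdefD].
apply/matrixP => i j; rewrite !mxE !fine_expectation.
have cM (f g : 'rV[R]_d * 'rV[R]_d -> R) : continuous f -> continuous g ->
    continuous (f \* g).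
  by move=> cf cg x; apply: continuousM; [exact: cf|exact: cg].
pose int (f : 'rV[R]_d * 'rV[R]_d -> R) (cf : continuous f) :=
  integrable_pair iW cK WK cf (isT : 1%N != 0%N).
have i11 := int _ (cM _ _ (c1 _ (cE i)) (c1 _ (cE j))).
have i10 := int _ (cM _ _ (c1 _ (cE i)) (c2 _ (cE j))).
have i01 := int _ (cM _ _ (c2 _ (cE i)) (c1 _ (cE j))).
have i00 := int _ (cM _ _ (c2 _ (cE i)) (c2 _ (cE j))).
have e10 := expectation_independent iW cK WK (cE i) (cE j) (isT : 1%N != 0%N).
have e01 := expectation_independent iW cK WK (cE j) (cE i) (isT : 1%N != 0%N).
rewrite !mean0 mulr0 in e10 e01.
under eq_Rintegral => w _.
  rewrite !TE /= (_ : _ * _ = c ^+ 2 *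
    ((W 1%N w 0 i * W 1%N w 0 j + W 0%N w 0 i * W 0%N w 0 j) -
     (W 1%N w 0 i * W 0%N w 0 j + W 1%N w 0 j * W 0%N w 0 i))); last by ring.
  over.
have i01' : P.-integrable setT (EFin \o (fun w => W 1%N w 0 j * W 0%N w 0 i)).
  by apply: eq_integrable i01 => // w _; rewrite /= mulrC.
rewrite RintegralZl//; last first.
  by apply: integrable_realB;
    [exact: integrable_realD i11 i00|exact: integrable_realD i10 i01'].
rewrite RintegralB//; last 2 first.
- exact: integrable_realD i11 i00.
- exact: integrable_realD i10 i01'.
by rewrite !RintegralD// e10 e01 addr0 subr0.
Qed.

End exploration.

(** * Exploration gains *)

Section gain.
Context {R : realType} {d : nat}.
Implicit Types (phi : 'rV[R]_d -> R) (a : 'rV[R]_d -> 'rV[R]_d) (x y v : 'rV[R]_d).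
Local Notation D := (d.+1%:R : R).

(* Nonnegativity at the minimiser of the quadratic upper bound of [phi] along
   [- a x] gives |a x|^2 <= 4 C^2 phi x. *)
Lemma sqrt_lipschitz phi a (C : R) : 1 <= C -> (forall x, 0 <= phi x) ->
  (forall x v, `|phi (x + v) - phi x - dotp (a x) v| <= C * `|v| ^+ 2) ->
  forall x y, `|Num.sqrt (phi x) - Num.sqrt (phi y)| <= D * C * `|x - y|.
Proof.
move=> C1 phi0 phiC.
have C0 : 0 < C by rewrite (lt_le_trans _ C1).
have D1 : 1 <= D by rewrite ler1n.
have aphi x : `|a x| <= 2 * C * Num.sqrt (phi x).
  have r0 : 0 <= 2 * C * Num.sqrt (phi x).
    by rewrite mulr_ge0 ?sqrtr_ge0// mulr_ge0// ltW.
  rewrite -ler_sqr ?nnegrE// [in leRHS]exprMn sqr_sqrtr//.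
  have := phiC x (- (2 * C)^-1 *: a x).
  rewrite ler_norml => /andP[_].
  rewrite dotpZr normrZ normrN gtr0_norm ?invr_gt0 ?mulr_gt0//.
  have := phi0 (x + - (2 * C)^-1 *: a x); have := dotp_ge (a x).
  set A := `|a x|; set P' := phi (x + _); set Q := dotp _ _ => AQ P0 h.
  have c20 : 0 < (2 * C)^-1 by rewrite invr_gt0 mulr_gt0.
  have t : (2 * C)^-1 * A ^+ 2 <= (2 * C)^-1 * Q by rewrite ler_wpM2l ?(ltW c20).
  have h2 : C * ((2 * C)^-1 * A) ^+ 2 = (2 * C)^-1 * A ^+ 2 / 2.
    by rewrite exprMn; field; rewrite gt_eqF.
  rewrite h2 in h.
  have h3 : (2 * C)^-1 * A ^+ 2 <= 2 * phi x by lra.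
  have h4 : A ^+ 2 <= 2 * phi x * (2 * C).
    by rewrite -ler_pdivrMr ?mulr_gt0// mulrC.
  apply: le_trans h4 _; rewrite exprMn.
  have := ler_wpM2r (phi0 x) C1; rewrite mul1r => h5.
  have := ler_wpM2l (ltW C0) h5; lra.
(* After squaring, [aphi] fits the linear Taylor term into the cross term, and [1 <= C] fits the
   quadratic one into [(D * C * |v|)^2]. Exchanging the two points gives the other inequality. *)
have half x v : Num.sqrt (phi (x + v)) <= Num.sqrt (phi x) + D * C * `|v|.
  have s0 := sqrtr_ge0 (phi x); have sE := sqr_sqrtr (phi0 x).
  have K0 : 0 <= D * C * `|v| by rewrite !mulr_ge0// ltW.
  rewrite -[leRHS]ger0_norm ?addr_ge0// -sqrtr_sqr ler_sqrt ?sqr_ge0//.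
  rewrite sqrrD sE.
  have := phiC x v; rewrite ler_norml => /andP[_ h].
  have h1 := le_trans (ler_norm _) (dotp_le (a x) v).
  have h2 : D * (`|a x| * `|v|) <= D * C * `|v| * Num.sqrt (phi x) * 2.
    have -> : D * C * `|v| * Num.sqrt (phi x) * 2 = D * (2 * C * Num.sqrt (phi x) * `|v|).
      by ring.
    by rewrite ler_wpM2l// ler_wpM2r.
  have h3 : C * `|v| ^+ 2 <= (D * C * `|v|) ^+ 2.
    rewrite exprMn ler_wpM2r ?exprn_ge0// exprMn.
    have h4 : C <= C ^+ 2 by rewrite expr2 ler_peMl// ltW.
    by rewrite (le_trans h4)// ler_peMl ?exprn_ge0 ?(ltW C0)// exprn_ege1.
  have -> : Num.sqrt (phi x) * (D * C * `|v|) *+ 2 = D * C * `|v| * Num.sqrt (phi x) * 2.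
    by rewrite -mulr_natr; ring.
  lra.
move=> x y; rewrite ler_norml; apply/andP; split.
  have := half x (y - x); rewrite addrC subrK distrC; lra.
have := half y (x - y); rewrite addrC subrK; lra.
Qed.

Lemma sqrt_differentiable phi x : 0 < phi x -> differentiable phi x ->
  differentiable (fun y => Num.sqrt (phi y)) x.
Proof.
move=> p0 dp; apply: (differentiable_comp (g := Num.sqrt)) => //.
by apply/derivable1_diffP; have [] := is_derive1_sqrt p0.
Qed.

(** The Lipschitz constant and the value at [xo] are both proportional to [eb]; [Ke] has to be found
    before [eb], so that the later constants do not depend on it. *)
Record gain_bound (Ke eb : R) xo (e : 'rV[R]_d -> R) : Prop := GainBound {
  gain_gt0 : forall x, 0 < e x;
  gain_lipschitz : forall x y, `|e x - e y| <= Ke * eb * `|x - y|;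
  gain_at : e xo <= Ke * eb;
  gain_differentiable : forall x, differentiable e x }.

(** Both gains are [eb] times the square root of a function [phi >= 1] with quadratic Taylor error.
    The lower bound keeps [phi] away from the singularity of the square root. *)
Lemma sqrt_gain_bound phi a (C : R) xo : 1 <= C -> (forall x, 1 <= phi x) ->
  (forall x v, `|phi (x + v) - phi x - dotp (a x) v| <= C * `|v| ^+ 2) ->
  exists2 Ke, 0 < Ke & forall eb, 0 < eb ->
    gain_bound Ke eb xo (fun x => eb * Num.sqrt (phi x)).
Proof.
move=> C1 phi1 phiC; have phi0 x : 0 < phi x by exact: lt_le_trans (phi1 x).
have DC : 0 < D * C by rewrite mulr_gt0// (lt_le_trans _ C1).
exists (D * C + Num.sqrt (phi xo)); first by rewrite ltr_wpDr// sqrtr_ge0.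
move=> eb eb0; split.
- by move=> x; rewrite mulr_gt0// sqrtr_gt0.
- move=> x y; rewrite -mulrBr normrM gtr0_norm// (mulrC _ eb) -mulrA.
  rewrite ler_wpM2l ?(ltW eb0)//.
  apply: le_trans (sqrt_lipschitz C1 (fun x => ltW (phi0 x)) phiC x y) _.
  by rewrite ler_wpM2r// lerDl sqrtr_ge0.
- by rewrite mulrC ler_wpM2r ?(ltW eb0)// lerDr ltW.
- move=> x; apply: (differentiableZ (f := fun x => Num.sqrt (phi x))).
  apply: sqrt_differentiable => //.
  by have [] := diff_quadratic_error (phiC x).
Qed.

Lemma exploration_gain_bound (Gamma : 'rV[R]_d -> R) (L : R) eps xo : 1 <= L ->
  (forall x, differentiable Gamma x) ->
  (forall x y, `|grad Gamma x - grad Gamma y| <= L * `|x - y|) ->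
  exploration_gain Gamma eps ->
  exists2 Ke, 0 < Ke & forall eb, 0 < eb -> gain_bound Ke eb xo (eps eb).
Proof.
move=> L1 dG GL [[ctr [sigma [s0 ->]]]|[Gmin [Gm ->]]].
  have s20 : 0 < sigma ^- 2 by rewrite invr_gt0 exprn_gt0.
  apply: (@sqrt_gain_bound (fun x => 1 + enorm (x - ctr) ^+ 2 / sigma ^+ 2)
    (fun x => sigma ^- 2 *: (2 *: (x - ctr))) (1 + D / sigma ^+ 2)).
  - by rewrite lerDl divr_ge0 ?exprn_ge0// ltW.
  - by move=> x; rewrite lerDl divr_ge0 ?sqr_ge0.
  move=> x v; rewrite !sqr_enorm dotpZl.
  have -> : 1 + dotp (x + v - ctr) (x + v - ctr) / sigma ^+ 2 -
      (1 + dotp (x - ctr) (x - ctr) / sigma ^+ 2) -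
      sigma ^- 2 * dotp (2 *: (x - ctr)) v = sigma ^- 2 * dotp v v.
    by rewrite -(sqr_dotp_expand x v ctr); ring.
  rewrite normrM gtr0_norm// mulrDl mul1r.
  apply: (@le_trans _ _ (D / sigma ^+ 2 * `|v| ^+ 2)); last by rewrite lerDr sqr_ge0.
  rewrite (mulrC D) -mulrA ler_wpM2l ?(ltW s20)//.
  by rewrite expr2; exact: dotp_le.
apply: (@sqrt_gain_bound (fun x => 1 + Gamma x - Gmin) (grad Gamma) (D * L)).
- by rewrite (le_trans L1)// ler_peMl ?ler1n// (le_trans _ L1).
- by move=> x; rewrite -addrA lerDl subr_ge0.
- move=> x v; have := taylor1 x v dG GL; congr (`|_| <= _); ring.
Qed.

End gain.

(** * The mean field as a biased gradient field *)

Section continuous_arithmetic.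
Context {R : realType} {T : topologicalType}.
Implicit Types f g : T -> R.

Lemma continuous_cst_fun (k : R) : continuous (fun _ : T => k).
Proof. by move=> x; exact: cst_continuous. Qed.

Lemma continuous_mul f g : continuous f -> continuous g ->
  continuous (fun x => f x * g x).
Proof. by move=> cf cg x; exact: (continuousM (cf x) (cg x)). Qed.

Lemma continuous_sub f g : continuous f -> continuous g ->
  continuous (fun x => f x - g x).
Proof. by move=> cf cg x; exact: (continuousB (cf x) (cg x)). Qed.

Lemma continuous_add f g : continuous f -> continuous g ->
  continuous (fun x => f x + g x).
Proof. by move=> cf cg x; exact: (continuousD (cf x) (cg x)). Qed.

End continuous_arithmetic.

Section noise_functional_theory.
Context {R : realType} {d : nat} (E : ('rV[R]_d -> R) -> R) (M : R).
Hypothesis nE : noise_functional E M.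
Implicit Types (f g : 'rV[R]_d -> R).

Lemma noise0 : E (fun=> 0) = 0.
Proof.
have c0 : continuous (fun _ : 'rV[R]_d => 0 : R).
  by move=> x; exact: cst_continuous.
have h : E (fun=> 0) = 1 * E (fun=> 0) + E (fun=> 0).
  rewrite -(noise_linear nE 1 c0 c0); congr E.
  by apply/funext => x; rewrite mulr0 addr0.
by rewrite mul1r in h; rewrite -[LHS](addrK (E (fun=> 0))) -h subrr.
Qed.

Lemma noiseZ k f : continuous f -> E (fun x => k * f x) = k * E f.
Proof.
move=> cf; have c0 : continuous (fun _ : 'rV[R]_d => 0 : R).
  by move=> x; exact: cst_continuous.
rewrite -[RHS]addr0 -noise0 -(noise_linear nE k cf c0); congr E.
by apply/funext => x; rewrite addr0.
Qed.

Lemma noiseD f g : continuous f -> continuous g ->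
  E (fun x => f x + g x) = E f + E g.
Proof.
move=> cf cg; rewrite -[E f]mul1r -(noise_linear nE 1 cf cg); congr E.
by apply/funext => x; rewrite mul1r.
Qed.

Lemma noiseB f g : continuous f -> continuous g ->
  E (fun x => f x - g x) = E f - E g.
Proof.
move=> cf cg; rewrite addrC -mulN1r -(noise_linear nE (-1) cg cf); congr E.
by apply/funext => x; rewrite mulN1r addrC.
Qed.

Lemma noise_sum n (f : 'I_n -> 'rV[R]_d -> R) : (forall i, continuous (f i)) ->
  E (fun x => \sum_i f i x) = \sum_i E (f i).
Proof.
move=> cf; suff h (s : seq 'I_n) : continuous (fun x => \sum_(i <- s) f i x) /\
    E (fun x => \sum_(i <- s) f i x) = \sum_(i <- s) E (f i) by have [] := h (index_enum _).
elim: s => [|i s [cs es]].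
  rewrite (_ : (fun _ => _) = fun=> 0); last by apply/funext => x; rewrite big_nil.
  by rewrite big_nil noise0; split => // x; exact: cst_continuous.
rewrite (_ : (fun _ => _) = fun x => f i x + \sum_(j <- s) f j x); last first.
  by apply/funext => x; rewrite big_cons.
rewrite big_cons noiseD// es; split => //.
exact: continuous_add.
Qed.

Lemma noise_norm_le f (C : R) : continuous f ->
  (forall x, `|x| <= M -> `|f x| <= C) -> `|E f| <= C.
Proof.
move=> cf fC; rewrite ler_norml; apply/andP; split.
  rewrite lerNl -mulN1r -noiseZ//; apply: (noise_le nE).
    exact: (continuous_mul (@continuous_cst_fun _ _ (-1)) cf).
  by move=> x /fC; rewrite ler_norml mulN1r lerNl => /andP[].
by apply: (noise_le nE) => // x /fC; rewrite ler_norml => /andP[].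
Qed.

End noise_functional_theory.

Section mean_field_bounds.
Context {R : realType} {d : nat} (Gamma : 'rV[R]_d -> R) (L : R).
Context (E : ('rV[R]_d -> R) -> R) (M : R) (e : 'rV[R]_d -> R) (Ke eb : R).
Context (xo : 'rV[R]_d).
Implicit Types (x y z u v : 'rV[R]_d).
Local Notation G := (grad Gamma).
Local Notation H := (hessian Gamma).
Local Notation D := (d.+1%:R : R).
Hypothesis L1 : 1 <= L.
Hypothesis dGamma : forall x, differentiable Gamma x.
Hypothesis dG : forall x, differentiable G x.
Hypothesis GL : forall x y, `|G x - G y| <= L * `|x - y|.
Hypothesis HL : forall x y, `|H x - H y| <= L * `|x - y|.
Hypothesis Gxo : G xo = 0.
Hypothesis nE : noise_functional E M.
Hypothesis eb0 : 0 < eb.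
Hypothesis Ke0 : 0 < Ke.
Hypothesis eK : gain_bound Ke eb xo e.

Let L0 : 0 <= L. Proof. exact: le_trans L1. Qed.
Let M0 : 0 <= M. Proof. exact: noise_ge0 nE. Qed.
Let e0 x : 0 < e x. Proof. exact: gain_gt0 eK _. Qed.

Definition fbar (th : 'rV[R]_d) : 'rV[R]_d :=
  \row_i E (fun x => spsa_field Gamma e th x 0 i).

Definition noise_cov : 'M[R]_d := \matrix_(i, j) E (fun x => x 0 i * x 0 j).

Definition bias (th : 'rV[R]_d) : 'rV[R]_d := fbar th + G th *m noise_cov.

Definition diffquot (th x : 'rV[R]_d) : R :=
  (Gamma (th + e th *: x) - Gamma th) / e th.

Let cGamma : continuous Gamma.
Proof. by move=> x; exact: differentiable_continuous. Qed.

Let cshift (th : 'rV[R]_d) (k : R) : continuous (fun x => Gamma (th + k *: x)).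
Proof.
move=> x; apply: (continuous_comp (f := fun x => th + k *: x)); last exact: cGamma.
apply: continuousD; first exact: cst_continuous.
exact: scaler_continuous.
Qed.

Let ccoord i : continuous (fun x : 'rV[R]_d => x 0 i : R).
Proof. by move=> x; exact: coord_continuous. Qed.

Let cmul (f g : 'rV[R]_d -> R) : continuous f -> continuous g ->
  continuous (fun x => f x * g x).
Proof. exact: continuous_mul. Qed.

Let csub (f g : 'rV[R]_d -> R) : continuous f -> continuous g ->
  continuous (fun x => f x - g x).
Proof. exact: continuous_sub. Qed.

Let ccst (k : R) : continuous (fun _ : 'rV[R]_d => k).
Proof. by move=> x; exact: cst_continuous. Qed.

Let cquot th : continuous (diffquot th).
Proof. by apply: cmul => //; apply: csub. Qed.

Lemma spsa_fieldE th x i :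
  spsa_field Gamma e th x 0 i = - (e th)^-1 * (Gamma (th + e th *: x) * x 0 i).
Proof. by rewrite /spsa_field !mxE; ring. Qed.

Lemma spsa_field_continuous th i :
  continuous (fun x => spsa_field Gamma e th x 0 i).
Proof.
rewrite (_ : (fun _ => _) = fun x => - (e th)^-1 * (Gamma (th + e th *: x) * x 0 i)).
  by apply: cmul => //; apply: cmul.
by apply/funext => x; rewrite spsa_fieldE.
Qed.

(** Since the noise has mean zero, [Gamma th] can be subtracted for free, which turns the singular
    factor [1 / e th] into a difference quotient. *)
Lemma fbarE th i : fbar th 0 i = - E (fun x => diffquot th x * x 0 i).
Proof.
rewrite mxE -[RHS]addr0 -[X in _ + X](mulr0 (- Gamma th / e th)) -(noise_mean0 nE i).
rewrite -mulN1r -(noiseZ nE)//; last by apply: cmul.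
rewrite -(noiseZ nE)// -(noiseD nE); last 2 first.
- by apply: cmul => //; apply: cmul.
- exact: cmul.
by congr E; apply/funext => x; rewrite spsa_fieldE /diffquot; ring.
Qed.

Lemma grad_noise_cov th i :
  (G th *m noise_cov) 0 i = E (fun x => dotp (G th) x * x 0 i).
Proof.
rewrite (_ : (fun _ => _) = fun x => \sum_j G th 0 j * (x 0 j * x 0 i)); last first.
  apply/funext => x; rewrite mulr_suml; apply: eq_bigr => j _; by rewrite mulrA.
rewrite (noise_sum nE); last by move=> j; apply: cmul => //; apply: cmul.
rewrite mxE; apply: eq_bigr => j _; rewrite [noise_cov j i]mxE (noiseZ nE)//.
exact: cmul.
Qed.

Lemma biasE th i :
  bias th 0 i = - E (fun x => (diffquot th x - dotp (G th) x) * x 0 i).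
Proof.
rewrite mxE fbarE grad_noise_cov addrC -opprB -(noiseB nE).
- by congr (- E _); apply/funext => x; ring.
- exact: cmul.
- by apply: cmul => //; exact: dotp_continuous.
Qed.

(** Both quotients are run by the same parameter [s]. In the derivative the increment [e t *: x]
    cancels the factor [1 / e t], so gradients at corresponding points are compared and no inverse
    gain remains. *)
Lemma diffquot_mvt th th' x (c B : R) :
  (forall s : R, 0 < s < 1 ->
    `|dotp (G (th + s *: (e th *: x)) - G (th' + s *: (e th' *: x))) x - c| <= B) ->
  `|diffquot th x - diffquot th' x - c| <= B.
Proof.
move=> hB.
have dq (t : 'rV[R]_d) (s : R) : is_derive s 1
    (fun s => (e t)^-1 *: (Gamma (t + s *: (e t *: x)) : R))
    ((e t)^-1 * dotp (G (t + s *: (e t *: x))) (e t *: x)).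
  by apply: is_deriveZ; exact: is_derive_grad.
have dc (s : R) : is_derive s 1 (fun s => s * c) (1 * c).
  by apply: is_derive_eq; rewrite scaler0 add0r -mulr_algr scaler1.
have := MVT01 (C := B) (fun s : R => is_deriveB (is_deriveB (dq th s) (dq th' s)) (dc s)).
have -> : forall f g h : R -> R, (f - g - h) 1 - (f - g - h) 0 =
  (f 1 - f 0) - (g 1 - g 0) - (h 1 - h 0) by move=> f g h; rewrite !fctE; ring.
rewrite !scale1r !scale0r !addr0 mul0r subr0 mul1r.
rewrite -!mulrBr ![_^-1 * (_ - _)]mulrC; apply => s s01.
rewrite !dotpZr !mulKf ?gt_eqF// -dotpBl; exact: hB.
Qed.

Lemma rV_subE u v i : (u - v) 0 i = u 0 i - v 0 i.
Proof. by rewrite !mxE. Qed.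

Lemma mul_entry_le (k c : R) x i : 0 <= c -> `|k| <= c -> `|x| <= M ->
  `|k * x 0 i| <= c * M.
Proof.
by move=> c0 kc xM; rewrite normrM ler_pM// (le_trans (entry_le x 0 i)).
Qed.

(** Serves the global existence of the mean flow, so the constant need not be small and may depend
    on [eb]. *)
Lemma fbar_lipschitz : exists2 K, 0 < K &
  forall th th', `|fbar th - fbar th'| <= K * `|th - th'|.
Proof.
have [B BE B0] : exists2 B, B = D * (L * (1 + Ke * eb * M) * M) & 0 <= B.
  eexists; first by [].
  by rewrite !mulr_ge0// addr_ge0// !mulr_ge0// ltW.
exists (B * M + 1); first by rewrite ltr_wpDl// mulr_ge0.
move=> th th'; apply: (@le_trans _ _ (B * M * `|th - th'|)); last first.
  by rewrite ler_wpM2r// lerDl.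
apply: rVnorm_le => [|i]; first by rewrite !mulr_ge0.
rewrite rV_subE !fbarE -opprD -(noiseB nE); [|exact: cmul|exact: cmul].
rewrite normrN mulrAC; apply: (noise_norm_le nE); first by apply: csub; apply: cmul.
move=> x xM; rewrite -mulrBl; apply: mul_entry_le => //; first by rewrite mulr_ge0.
rewrite -[X in `|X|]subr0; apply: diffquot_mvt => s /andP[s0 s1].
rewrite subr0 (le_trans (dotp_le _ _))// BE -!mulrA ler_wpM2l//.
rewrite (_ : L * _ = L * (1 + Ke * eb * M) * `|th - th'| * M); last by ring.
rewrite ler_pM// (le_trans (GL _ _))// -mulrA ler_wpM2l//.
rewrite opprD addrACA -scalerBr -scalerBl (le_trans (ler_normD _ _))//.
rewrite mulrDl mul1r lerD// 2!normrZ (gtr0_norm s0).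
apply: (@le_trans _ _ (`|e th - e th'| * `|x|)).
  by rewrite ler_piMl// ?mulr_ge0// ltW.
by rewrite mulrAC ler_pM// (gain_lipschitz eK).
Qed.

Lemma gain_growth y : e y <= Ke * eb * (1 + `|y - xo|).
Proof.
have := gain_lipschitz eK y xo; have := gain_at eK; rewrite ler_norml mulrDr mulr1.
by move=> h /andP[_]; lra.
Qed.

(* The constant involves the size of [th'] only: after replacing the gain at
   [th] by the gain at [th'], what remains is a mixed second difference of the
   gradient, which the Lipschitz constant of the Hessian controls globally. *)
Lemma bias_lipschitz th th' : `|bias th - bias th'| <=
  D * (L * M + D * L * M) * Ke * M * M * (eb * (1 + `|th' - xo|) * `|th - th'|).
Proof.
have [B BE B0] : exists2 B, B = D * (L * M + D * L * M) * Ke * M & 0 <= B.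
  eexists; first by [].
  by rewrite !mulr_ge0// ?addr_ge0// ?mulr_ge0// ltW.
rewrite -BE.
have C0 : 0 <= eb * (1 + `|th' - xo|) * `|th - th'|.
  by rewrite !mulr_ge0// ?addr_ge0// ltW.
apply: rVnorm_le => [|i]; first exact: (mulr_ge0 (mulr_ge0 B0 M0) C0).
rewrite rV_subE !biasE -opprD normrN.
have cq t : continuous (fun x => (diffquot t x - dotp (G t) x) * x 0 i).
  by apply: cmul => //; apply: csub => //; exact: dotp_continuous.
rewrite -(noiseB nE)// mulrAC; apply: (noise_norm_le nE); first exact: csub.
move=> x xM; rewrite -mulrBl; apply: mul_entry_le => //.
  exact: mulr_ge0 B0 C0.
rewrite (_ : _ - _ = diffquot th x - diffquot th' x - dotp (G th - G th') x); last first.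
  by rewrite dotpBl; ring.
apply: diffquot_mvt => s /andP[s0 s1].
rewrite -dotpBl (le_trans (dotp_le _ _))//.
have g1 : `|G (th + s *: (e th *: x)) - G (th + s *: (e th' *: x))| <=
    L * M * Ke * (eb * (1 + `|th' - xo|) * `|th - th'|).
  rewrite (le_trans (GL _ _))// opprD addrACA subrr add0r -scalerBr -scalerBl.
  rewrite 2!normrZ (gtr0_norm s0).
  have h1 : `|e th - e th'| * `|x| <= Ke * eb * `|th - th'| * M.
    by rewrite ler_pM// (gain_lipschitz eK).
  have h2 : s * (`|e th - e th'| * `|x|) <= `|e th - e th'| * `|x|.
    by rewrite ler_piMl// ?mulr_ge0// ltW.
  have h3 : Ke * eb * `|th - th'| * M <= M * Ke * (eb * (1 + `|th' - xo|) * `|th - th'|).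
    have -> : M * Ke * (eb * (1 + `|th' - xo|) * `|th - th'|) =
      Ke * eb * `|th - th'| * M * (1 + `|th' - xo|) by ring.
    by rewrite ler_peMr ?lerDl// !mulr_ge0// ltW.
  apply: le_trans (ler_wpM2l L0 (le_trans h2 (le_trans h1 h3))) _.
  by rewrite !mulrA.
have g2 : `|G (th + s *: (e th' *: x)) - G th - G (th' + s *: (e th' *: x)) + G th'| <=
    D * L * M * Ke * (eb * (1 + `|th' - xo|) * `|th - th'|).
  have := grad_mixed L0 dG HL th' (th - th') (s *: (e th' *: x)).
  rewrite (addrC th') subrK => /le_trans; apply.
  rewrite -!mulrA ler_wpM2l// ler_wpM2l// 2!normrZ (gtr0_norm s0) (gtr0_norm (e0 _)).
  have h1 : e th' * `|x| <= Ke * eb * (1 + `|th' - xo|) * M.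
    by apply: ler_pM => //; [exact: ltW|exact: gain_growth].
  have h2 : s * (e th' * `|x|) <= e th' * `|x|.
    by rewrite ler_piMl ?mulr_ge0// ltW.
  have h3 := ler_wpM2l (normr_ge0 (th - th')) (le_trans h2 h1).
  apply: le_trans h3 _; rewrite le_eqVlt; apply/orP; left; apply/eqP; ring.
have g3 : `|G (th + s *: (e th *: x)) - G (th' + s *: (e th' *: x)) - (G th - G th')|
   <= (L * M + D * L * M) * Ke * (eb * (1 + `|th' - xo|) * `|th - th'|).
  rewrite (_ : _ - _ = (G (th + s *: (e th *: x)) - G (th + s *: (e th' *: x))) +
    (G (th + s *: (e th' *: x)) - G th - G (th' + s *: (e th' *: x)) + G th')); last first.
    by rewrite opprB; apply/rowP => j; rewrite !(rV_subE, mxE); ring.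
  by rewrite (le_trans (ler_normD _ _))// 2!mulrDl lerD.
have h := ler_pM (normr_ge0 _) (normr_ge0 _) g3 xM.
apply: le_trans (ler_wpM2l (ltW (ltr0Sn R d)) h) _.
rewrite le_eqVlt; apply/orP; left; apply/eqP; rewrite BE; ring.
Qed.

(** At the minimiser the gradient vanishes, so the quotient is a Taylor remainder of order
    [e xo ^ 2] divided by [e xo], hence of order [eb]. *)
Lemma bias_at : `|bias xo| <= D * L * M * M * Ke * M * eb.
Proof.
apply: rVnorm_le => [|i]; first by rewrite !mulr_ge0// ltW.
rewrite biasE normrN Gxo.
have cq : continuous (fun x => diffquot xo x - dotp 0 x).
  by apply: csub => //; exact: dotp_continuous.
rewrite mulrAC; apply: (noise_norm_le nE); first exact: cmul.
move=> x xM; apply: mul_entry_le => //; first by rewrite !mulr_ge0// ltW.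
rewrite dotpC dotp0r subr0 /diffquot normrM normfV (gtr0_norm (e0 _)) ler_pdivrMr//.
have := taylor1 xo (e xo *: x) dGamma GL; rewrite Gxo dotpC dotp0r subr0.
move=> /le_trans; apply; rewrite normrZ (gtr0_norm (e0 _)) exprMn.
have h1 : e xo ^+ 2 <= e xo * (Ke * eb).
  by rewrite expr2 ler_wpM2l ?(gain_at eK)// ltW.
have h2 : `|x| ^+ 2 <= M * M by rewrite expr2 ler_pM.
have h3 := ler_pM (exprn_ge0 2 (ltW (e0 xo))) (exprn_ge0 2 (normr_ge0 x)) h1 h2.
apply: le_trans (ler_wpM2l (mulr_ge0 (ltW (ltr0Sn R d)) L0) h3) _.
rewrite le_eqVlt; apply/orP; left; apply/eqP; ring.
Qed.

(** The gain is known to be differentiable and Lipschitz, without a quadratic error of its own.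
    Subtracting [b * e], with [b] the derivative of [psi] in the gain, leaves a function whose
    Taylor error is quadratic; [b * e] is then added back. *)
Lemma fbar_differentiable th : differentiable fbar th.
Proof.
suff dfi i : differentiable (fun t => fbar t 0 i) th.
  rewrite (_ : fbar = \sum_i (fun t => fbar t 0 i *: delta_mx 0 i)).
    by apply: differentiable_sum => i; exact: differentiableZl.
  by apply/funext => t; rewrite fct_sumE -row_sum_delta.
pose psi t := E (fun x => Gamma (t + e t *: x) * x 0 i).
have cpsi t : continuous (fun x : 'rV[R]_d => Gamma (t + e t *: x) * x 0 i).
  exact: cmul.
have cG y j : continuous (fun x : 'rV[R]_d => G (th + e y *: x) 0 j).
  move=> x; apply: (continuous_comp (f := fun x => G (th + e y *: x))
    (g := fun v : 'rV[R]_d => v 0 j)); last exact: coord_continuous.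
  apply: (continuous_comp (f := fun x => th + e y *: x)).
    by apply: continuousD; [exact: cst_continuous|exact: scaler_continuous].
  exact/differentiable_continuous/dG.
(* [b] is the derivative of [psi] in the value of the gain, and [a] the gradient of [psi] with the
   gain frozen at [th]. *)
pose b := \sum_j E (fun x => G (th + e th *: x) 0 j * x 0 j * x 0 i).
pose a := \row_j E (fun x => G (th + e th *: x) 0 j * x 0 i).
pose C := D * L * (1 + Ke * eb * M) ^+ 2 * M.
(* The argument of [Gamma] moves by [w x], of norm at most [(1 + Ke * eb * M) * |v|]. Its
   first-order effect, averaged, is the [a] part plus [b] times the gain increment. *)
have chiC v : `|(psi (th + v) - b * e (th + v)) - (psi th - b * e th) -
    dotp a v| <= C * `|v| ^+ 2.
  pose w x := v + (e (th + v) - e th) *: x.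
  have -> : (psi (th + v) - b * e (th + v)) - (psi th - b * e th) - dotp a v =
      E (fun x => (Gamma (th + e th *: x + w x) - Gamma (th + e th *: x) -
        dotp (G (th + e th *: x)) (w x)) * x 0 i).
    have -> : (fun x => (Gamma (th + e th *: x + w x) - Gamma (th + e th *: x) -
        dotp (G (th + e th *: x)) (w x)) * x 0 i) =
      (fun x => Gamma (th + v + e (th + v) *: x) * x 0 i
        - Gamma (th + e th *: x) * x 0 i
        - (\sum_j v 0 j * (G (th + e th *: x) 0 j * x 0 i)
          + (e (th + v) - e th) * \sum_j G (th + e th *: x) 0 j * x 0 j * x 0 i)).
      apply/funext => x.
      have -> : th + e th *: x + w x = th + v + e (th + v) *: x.
        by apply/rowP => j; rewrite !mxE; ring.
      rewrite mulrBl mulrBl; congr (_ - _).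
      rewrite /w dotpDr dotpZr mulrDl; congr (_ + _).
        by rewrite mulr_suml; apply: eq_bigr => j _; ring.
      by rewrite -mulrA mulr_suml.
    have c1 j : continuous (fun x => G (th + e th *: x) 0 j * x 0 i) by exact: cmul.
    have c2 j : continuous (fun x => v 0 j * (G (th + e th *: x) 0 j * x 0 i)).
      exact: cmul.
    have c3 j : continuous (fun x => G (th + e th *: x) 0 j * x 0 j * x 0 i).
      by apply: cmul => //; exact: cmul.
    have c4 : continuous (fun x => \sum_j v 0 j * (G (th + e th *: x) 0 j * x 0 i)).
      move=> x; apply: (sum_continuous
        (F := fun j x => v 0 j * (G (th + e th *: x) 0 j * x 0 i))) => j.
      exact: c2.
    have c5 : continuous (fun x => \sum_j G (th + e th *: x) 0 j * x 0 j * x 0 i).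
      move=> x; apply: (sum_continuous
        (F := fun j x => G (th + e th *: x) 0 j * x 0 j * x 0 i)) => j.
      exact: c3.
    have c6 : continuous (fun x => (e (th + v) - e th) *
        \sum_j G (th + e th *: x) 0 j * x 0 j * x 0 i).
      exact: cmul.
    rewrite (noiseB nE); last 2 first.
    - by apply: csub.
    - exact: continuous_add.
    rewrite (noiseB nE)// (noiseD nE)// (noise_sum nE)// (noiseZ nE)// (noise_sum nE)//.
    rewrite -/(psi _) -/(psi _) -/b.
    have -> : \sum_j E (fun x => v 0 j * (G (th + e th *: x) 0 j * x 0 i)) = dotp a v.
      by apply: eq_bigr => j _; rewrite (noiseZ nE)// mxE mulrC.
    by ring.
  rewrite mulrAC; apply: (noise_norm_le nE).
    have cth : continuous (fun x => th + e th *: x).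
      by move=> x; apply: continuousD; [exact: cst_continuous|exact: scaler_continuous].
    apply: cmul => //; apply: csub; first apply: csub => //.
      rewrite (_ : (fun _ => _) = fun x => Gamma (th + v + e (th + v) *: x)) //.
      apply/funext => x; congr Gamma.
      by apply/rowP => j; rewrite !mxE; ring.
    rewrite (_ : (fun _ => _) = fun x => \sum_j G (th + e th *: x) 0 j * w x 0 j)//.
    move=> x; apply: (sum_continuous
      (F := fun j x => G (th + e th *: x) 0 j * w x 0 j)) => j.
    apply: cmul => //.
    rewrite (_ : (fun _ => _) = fun x => v 0 j - (- (e (th + v) - e th)) * x 0 j).
      by apply: csub => //; exact: cmul.
    by apply/funext => y; rewrite !mxE; ring.
  move=> x xM; apply: mul_entry_le => //.
    by rewrite mulr_ge0 ?sqr_ge0// mulr_ge0 ?sqr_ge0// mulr_ge0.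
  apply: le_trans (taylor1 _ _ dGamma GL) _.
  rewrite -[leRHS]mulrA ler_wpM2l ?mulr_ge0// -exprMn.
  have k0 : 0 <= 1 + Ke * eb * M by rewrite addr_ge0// !mulr_ge0// ltW.
  rewrite ler_sqr ?nnegrE// ?mulr_ge0//.
  rewrite mulrDl mul1r (le_trans (ler_normD _ _))// lerD2l normrZ mulrAC.
  rewrite ler_pM// (le_trans (gain_lipschitz eK _ _))//.
  by rewrite addrAC subrr add0r.
have [dchi _] := diff_quadratic_error (f := fun t => psi t - b * e t) chiC.
have dbe : differentiable (fun t => b *: (e t : R)) th.
  by apply: differentiableZ; exact: gain_differentiable eK _.
have dpsi : differentiable psi th.
  rewrite (_ : psi = (fun t => psi t - b * e t) + (fun t => b *: (e t : R))).
    exact: differentiableD.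
  by apply/funext => t; rewrite fctE/= subrK.
rewrite (_ : (fun t => fbar t 0 i) = - ((fun t => (e t)^-1) * psi)).
  apply: differentiableN; apply: differentiableM => //.
  by apply: differentiableV; [exact: gain_differentiable eK _|rewrite gt_eqF].
apply/funext => t; rewrite !fctE mxE -mulNr -(noiseZ nE)//.
by congr E; apply/funext => x; rewrite spsa_fieldE.
Qed.

End mean_field_bounds.

(** * Stability of perturbed gradient fields *)

Section fixed_point.
Context {R : realType} {d : nat}.
Implicit Types (x y p : 'rV[R]_d).

Lemma ball_contraction (T : 'rV[R]_d -> 'rV[R]_d) x0 (r : R) : 0 <= r ->
  (forall x y, `|x - x0| <= r -> `|y - x0| <= r ->
    `|T x - T y| <= `|x - y| / 2) ->
  `|T x0 - x0| <= r / 2 -> exists2 p, `|p - x0| <= r & T p = p.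
Proof.
move=> r0 hT hx0.
have x0r : `|x0 - x0| <= r by rewrite subrr normr0.
(* Contraction and initial displacement each contribute at most [r / 2], so the ball is
   invariant. *)
have Tr x : `|x - x0| <= r -> `|T x - x0| <= r.
  move=> xr; have := hT x x0 xr x0r; have := ler_distD (T x0) (T x) x0.
  lra.
pose u n := iter n T x0; pose a := `|T x0 - x0|.
have ur n : `|u n - x0| <= r by elim: n => //= n; exact: Tr.
have ua n : `|u n.+1 - u n| <= a / 2 ^+ n.
  elim: n => [|n IH]; first by rewrite expr0 divr1.
  rewrite exprSr invfM mulrA (le_trans (hT _ _ (ur n.+1) (ur n)))//.
  by rewrite ler_wpM2r// invr_ge0.
have [p up] := geometric_limit_rV ua.
have pr : `|p - x0| <= r.
  have := up 0%N; rewrite expr0 divr1 distrC /u/= => /le_trans; apply.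
  by rewrite /a; lra.
exists p => //; apply/eqP; rewrite -subr_eq0 -normr_le0.
apply/ler_addgt0Pr => e e0; rewrite add0r.
have [n hn] := pow2_small (2 * a) (divr_gt0 e0 (ltr0Sn R 1)).
have h1 := le_trans (up n) (hn n (leqnn n)).
have h2 := le_trans (up n.+1) (hn n.+1 (leqnSn n)).
have h3 := hT p (u n) pr (ur n).
have h4 := ler_distD (u n.+1) (T p) p.
rewrite distrC in h1; have : `|u n.+1 - T p| = `|T p - T (u n)| by rewrite distrC.
rewrite (distrC (T p) (u n.+1)) in h4 => h5; lra.
Qed.

End fixed_point.

Section hurwitz_criterion.
Context {R : realType} {d : nat}.
Local Notation toC := (map_mx (real_complex R)).

Lemma eigenvalue_tr (F : fieldType) n (A : 'M[F]_n) a :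
  eigenvalue A^T a = eigenvalue A a.
Proof.
rewrite /eigenvalue /eigenspace !kermx_eq0.
by rewrite -[A^T - _]trmxK linearB/= trmxK tr_scalar_mx /row_free mxrank_tr.
Qed.

Lemma Re_mulC (z : R[i]) (s : R) : complex.Re (z * s%:C%C) = complex.Re z * s.
Proof. by case: z => a b /=; rewrite mulr0 subr0. Qed.

Lemma Im_mulC (z : R[i]) (s : R) : complex.Im (z * s%:C%C) = complex.Im z * s.
Proof. by case: z => a b /=; rewrite mulr0 add0r. Qed.

(** Split a complex eigenvector into real and imaginary parts [p], [q] and add the two negative
    forms: by symmetry of [S] the imaginary part of the eigenvalue cancels, leaving its real part
    times a positive number. [J^T] matches the transposition in [jac]. *)
Lemma hurwitz_lyapunov (J S : 'M[R]_d) : posdef S ->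
  (forall v, v != 0 -> dotp (v *m S) (v *m J) < 0) -> hurwitz J^T.
Proof.
move=> [tS pS] neg z; rewrite -matrix.map_trmx eigenvalue_tr => /eigenvalueP[v vJ v0].
pose p : 'rV[R]_d := map_mx (@complex.Re R) v.
pose q : 'rV[R]_d := map_mx (@complex.Im R) v.
have pJ : p *m J = complex.Re z *: p - complex.Im z *: q.
  apply/rowP => j; have := congr1 (fun w : 'rV[R[i]]_d => complex.Re (w 0 j)) vJ.
  rewrite !mxE raddf_sum/= => h.
  rewrite (_ : \sum_i _ = \sum_i complex.Re (v 0 i * toC J i j)); last first.
    by apply: eq_bigr => i _; rewrite !mxE Re_mulC.
  by rewrite h; case: (z) => a b; case: (v 0 j).
have qJ : q *m J = complex.Im z *: p + complex.Re z *: q.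
  apply/rowP => j; have := congr1 (fun w : 'rV[R[i]]_d => complex.Im (w 0 j)) vJ.
  rewrite !mxE raddf_sum/= => h.
  rewrite (_ : \sum_i _ = \sum_i complex.Im (v 0 i * toC J i j)); last first.
    by apply: eq_bigr => i _; rewrite !mxE Im_mulC.
  by rewrite h; case: (z) => a b; case: (v 0 j) => s t /=; rewrite addrC.
have pq : p != 0 \/ q != 0.
  apply/orP; rewrite -negb_and; apply: contra v0 => /andP[/eqP p0 /eqP q0].
  apply/eqP/rowP => j; rewrite mxE.
  have := congr1 (fun w : 'rV[R]_d => w 0 j) p0; rewrite !mxE.
  have := congr1 (fun w : 'rV[R]_d => w 0 j) q0; rewrite !mxE.
  by case: (v 0 j) => s t /= -> ->.
have le0 (w : 'rV[R]_d) : dotp (w *m S) (w *m J) <= 0.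
  by have [->|/neg/ltW//] := eqVneq w 0; rewrite !mul0mx dotp0r.
have ge0 (w : 'rV[R]_d) : 0 <= dotp (w *m S) w.
  have [->|/pS/ltW] := eqVneq w 0; first by rewrite dotp0r.
  by rewrite -dotpE.
have gt0 (w : 'rV[R]_d) : w != 0 -> 0 < dotp (w *m S) w.
  by move=> /pS; rewrite -dotpE.
have sym : dotp (p *m S) q = dotp (q *m S) p by rewrite dotp_mulmxl tS dotpC.
have eq1 : dotp (p *m S) (p *m J) + dotp (q *m S) (q *m J) =
    complex.Re z * (dotp (p *m S) p + dotp (q *m S) q).
  by rewrite pJ qJ dotpBr dotpDr !dotpZr sym; ring.
have neg1 : dotp (p *m S) (p *m J) + dotp (q *m S) (q *m J) < 0.
  by case: pq => /neg h; [have := le0 q|have := le0 p]; lra.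
have pos1 : 0 < dotp (p *m S) p + dotp (q *m S) q.
  by case: pq => /gt0 h; [have := ge0 q|have := ge0 p]; lra.
by rewrite -(pmulr_llt0 _ pos1) -eq1.
Qed.

End hurwitz_criterion.

Section perturbed_gradient_field.
Context {R : realType} {d : nat} (Gamma : 'rV[R]_d -> R) (L : R) (xo : 'rV[R]_d).
Context (S : 'M[R]_d) (lam c k c0 : R) (F bias : 'rV[R]_d -> 'rV[R]_d) (C2 eb : R).
Implicit Types (x y u v : 'rV[R]_d).
Local Notation G := (grad Gamma).
Local Notation H := (hessian Gamma).
Local Notation D := (d.+1%:R : R).
Local Notation CS := (D * `|S|).
Hypothesis L1 : 1 <= L.
Hypothesis dGamma : forall x, differentiable Gamma x.
Hypothesis dG : forall x, differentiable G x.
Hypothesis GL : forall x y, `|G x - G y| <= L * `|x - y|.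
Hypothesis HL : forall x y, `|H x - H y| <= L * `|x - y|.
Hypothesis Gxo : G xo = 0.
Hypothesis Hpos : posdef (H xo).
Hypothesis c00 : 0 < c0.
Hypothesis Hexp : forall v, c0 * `|v| <= `|v *m H xo|.
Hypothesis lam0 : 0 < lam.
Hypothesis Slam : forall v, lam * `|v| ^+ 2 <= dotp (v *m S) v.
Hypothesis cp0 : 0 < c.
Hypothesis Gc : forall x, c * `|x - xo| <= `|G x|.
Hypothesis k0 : 0 < k.
Hypothesis growth : forall v, k * `|v| ^+ 2 <= Gamma (xo + v) - Gamma xo.
Hypothesis eb0 : 0 < eb.
Hypothesis C20 : 0 <= C2.
Hypothesis Fbias : forall x, F x = - (G x *m S) + bias x.
Hypothesis biasL : forall x y,
  `|bias x - bias y| <= C2 * (eb * (1 + `|y - xo|) * `|x - y|).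
Hypothesis bias0 : `|bias xo| <= C2 * eb.

Let L0 : 0 <= L. Proof. exact: le_trans L1. Qed.
Let D0 : 0 < D. Proof. by []. Qed.
Let DL0 : 0 < D * L. Proof. by rewrite mulr_gt0// (lt_le_trans _ L1). Qed.
Let CS0 : 0 <= CS. Proof. by rewrite mulr_ge0. Qed.

Lemma bias_lipschitz_near x y : `|y - xo| <= 1 ->
  `|bias x - bias y| <= 2 * C2 * eb * `|x - y|.
Proof.
move=> y1; rewrite (le_trans (biasL x y))//.
have -> : C2 * (eb * (1 + `|y - xo|) * `|x - y|) =
  C2 * eb * `|x - y| * (1 + `|y - xo|) by ring.
have -> : 2 * C2 * eb * `|x - y| = C2 * eb * `|x - y| * 2 by ring.
by rewrite ler_wpM2l ?mulr_ge0// ?(ltW eb0)//; lra.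
Qed.

Lemma grad_linear_near x y : `|G x - G y - (x - y) *m H xo| <=
  D * L * (`|y - xo| + `|x - y|) * `|x - y|.
Proof.
have := grad_linearize L0 dG HL xo y (x - y).
by rewrite (addrC y) subrK (proj1 Hpos) mulrA.
Qed.

Let M := invmx (H xo *m S).
Local Notation CM := (D * `|M|).

Let S_unit : S \in unitmx. Proof. exact: coercive_unitmx lam0 Slam. Qed.

Let H_unit : H xo \in unitmx.
Proof.
have [l l0 hl] := posdef_coercive Hpos; exact: coercive_unitmx l0 hl.
Qed.

Let HS_unit : H xo *m S \in unitmx. Proof. by rewrite unitmx_mul H_unit S_unit. Qed.

Let HSM : H xo *m S *m M = 1%:M. Proof. exact: mulmxV. Qed.

Let MHS : M *m (H xo *m S) = 1%:M. Proof. exact: mulVmx. Qed.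

(* A zero of [F] is a fixed point of the simplified Newton map. *)
Lemma perturbed_zero r : 0 < r -> r <= 1 ->
  CM * (CS * (3 * (D * L))) * r <= 4^-1 -> CM * (2 * C2) * eb <= 4^-1 ->
  CM * C2 * eb <= r / 2 ->
  exists2 xs, `|xs - xo| <= r & F xs = 0.
Proof.
move=> r0 r1 hr h1 h2; pose T x := x + F x *m M.
have CM0 : 0 <= CM by rewrite mulr_ge0.
have [||xs xsr Txs] := @ball_contraction _ _ T xo r (ltW r0).
- move=> x y xr yr.
  (* As [M] inverts [H xo *m S], the identity cancels the linearised gradient. The bias increment
     and the linearisation error remain, each worth at most a quarter of [|x - y|]. *)
  have -> : T x - T y = ((bias x - bias y) - (G x - G y - (x - y) *m H xo) *m S) *m M.
    have -> : T x - T y = (x - y) + (F x - F y) *m M.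
      by rewrite /T mulmxBl; apply/rowP => j; rewrite !(rV_subE, mxE); ring.
    have : x - y = (x - y) *m H xo *m S *m M.
      by rewrite -2!mulmxA (mulmxA (H xo)) HSM mulmx1.
    move: ((x - y) *m H xo) => A ->; rewrite -mulmxDl; congr (_ *m M).
    rewrite !Fbias !mulmxBl; move: (G x *m S) (G y *m S) (A *m S) => a b a'.
    by apply/rowP => j; rewrite !(rV_subE, mxE); ring.
  have xyr : `|x - y| <= 2 * r.
    by have := ler_distD xo x y; rewrite (distrC xo y); lra.
  have e1 := bias_lipschitz_near x (le_trans yr r1).
  have e2 : `|(G x - G y - (x - y) *m H xo) *m S| <= CS * (3 * (D * L)) * r * `|x - y|.
    apply: le_trans (mulmx_le _ _) _; rewrite -2!(mulrA CS) ler_wpM2l//.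
    apply: le_trans (grad_linear_near x y) _; rewrite ler_wpM2r//.
    have -> : 3 * (D * L) * r = D * L * (r + 2 * r) by ring.
    by rewrite ler_wpM2l ?(ltW DL0)// lerD.
  apply: le_trans (mulmx_le _ _) _.
  apply: le_trans (ler_wpM2l CM0 (le_trans (ler_normB _ _) (lerD e1 e2))) _.
  have := ler_wpM2r (normr_ge0 (x - y)) hr; have := ler_wpM2r (normr_ge0 (x - y)) h1.
  lra.
- rewrite /T (addrAC xo) subrr add0r Fbias Gxo mul0mx oppr0 add0r.
  apply: le_trans (mulmx_le _ _) _; apply: le_trans h2.
  by rewrite -[leRHS]mulrA ler_wpM2l.
exists xs => //.
have /eqP : F xs *m M = 0.
  by apply/eqP; rewrite -(subr_eq0 _ 0) subr0 -[_ *m _](addKr xs) -/(T xs) Txs addNr.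
move/eqP => FM; rewrite -[F xs]mulmx1 -MHS mulmxA.
by rewrite FM mul0mx.
Qed.

Section zero.
Context (xs : 'rV[R]_d) (r : R).
Hypothesis r0 : 0 < r.
Hypothesis r1 : r <= 1.
Hypothesis xsr : `|xs - xo| <= r.
Hypothesis Fxs : F xs = 0.

Let xs1 : `|xs - xo| <= 1. Proof. exact: le_trans r1. Qed.

Let FE x : F x = - ((G x - G xs) *m S) + (bias x - bias xs).
Proof.
by rewrite -[LHS]subr0 -Fxs !Fbias mulmxBl; apply/rowP => j; rewrite !(rV_subE, mxE); ring.
Qed.

(** Moving the centre from [xo] to [xs] changes gradient increments by [O(r |v|)] for every [v], not
    just small ones; this transports coercivity and growth from [xo] to [xs]. *)
Let mixed v : `|G (xs + v) - G xs - G (xo + v)| <= D * L * (r * `|v|).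
Proof.
have := grad_mixed L0 dG HL xo (xs - xo) v.
rewrite (addrC xo (xs - xo)) subrK Gxo addr0 => /le_trans; apply.
by rewrite ler_wpM2l ?(ltW DL0)// ler_wpM2r.
Qed.

(* Bregman divergences turn the Lyapunov function [Gamma] of the gradient flow
   into one centred at the shifted equilibrium [xs]. *)
Definition bregman x := Gamma x - Gamma xs - dotp (G xs) (x - xs).

Lemma bregman_taylor x v :
  `|bregman (x + v) - bregman x - dotp (G x - G xs) v| <= D * L * `|v| ^+ 2.
Proof.
have := taylor1 x v dGamma GL; congr (`|_| <= _).
by rewrite /bregman (addrAC x); move: (x - xs) => w; rewrite dotpDr dotpBl; ring.
Qed.

Lemma bregman_upper x : bregman x <= D * L * `|x - xs| ^+ 2.
Proof.
have := bregman_taylor xs (x - xs); rewrite (addrC xs) subrK subrr.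
rewrite {2}/bregman !subrr dotp0r dotpC dotp0r !subr0.
by apply: le_trans; exact: ler_norm.
Qed.

(** The divergence at [xs + v] is compared with [Gamma (xo + v) - Gamma xo], whose growth is known;
    by [mixed] and the mean value theorem they differ by at most half of that growth. *)
Lemma bregman_lower x : D * (D * L) * r <= k / 2 ->
  k / 2 * `|x - xs| ^+ 2 <= bregman x.
Proof.
move=> hr; set v := x - xs; have -> : x = xs + v by rewrite addrC subrK.
have h (s : R) : is_derive s 1 (fun t => (Gamma (xs + t *: v) - Gamma (xo + t *: v))
     - t * dotp (G xs) v)
   (dotp (G (xs + s *: v)) v - dotp (G (xo + s *: v)) v - 1 * dotp (G xs) v).
  apply: is_deriveB; first by apply: is_deriveB; exact: is_derive_grad.
  by apply: is_derive_eq; rewrite scaler0 add0r -mulr_algr scaler1.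
have := MVT01 (C := D * (D * L) * r * `|v| ^+ 2) h.
rewrite !scale1r !scale0r !addr0 mul0r subr0 mul1r => mvt.
have {mvt} : `|bregman (xs + v) - (Gamma (xo + v) - Gamma xo)| <=
    D * (D * L) * r * `|v| ^+ 2.
  rewrite /bregman (addrAC xs) subrr add0r.
  rewrite (_ : _ - _ = Gamma (xs + v) - Gamma (xo + v) - dotp (G xs) v -
    (Gamma xs - Gamma xo)); last by ring.
  apply: mvt => s /andP[s0 s1].
  have -> : dotp (G (xs + s *: v)) v - dotp (G (xo + s *: v)) v - dotp (G xs) v =
     dotp (G (xs + s *: v) - G xs - G (xo + s *: v)) v by rewrite !dotpBl; ring.
  apply: le_trans (dotp_le _ _) _.
  have h1 : `|G (xs + s *: v) - G xs - G (xo + s *: v)| <= D * L * (r * `|v|).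
    apply: le_trans (mixed _) _; rewrite ler_wpM2l ?(ltW DL0)//.
    by rewrite ler_wpM2l ?(ltW r0)// normrZ (gtr0_norm s0) ler_piMl// ltW.
  apply: le_trans (ler_wpM2l (ltW D0) (ler_wpM2r (normr_ge0 v) h1)) _.
  by rewrite le_eqVlt; apply/orP; left; apply/eqP; ring.
rewrite ler_norml => /andP[h1 _].
have := growth v; have := ler_wpM2r (exprn_ge0 2 (normr_ge0 v)) hr; lra.
Qed.

(** The dissipation [lam / 2 * (c / 2)^2 * |x - xs|^2] divided by the upper bound
    [D * L * |x - xs|^2] of the divergence. *)
Let mu := lam * c ^+ 2 / (8 * (D * L)).

(** With [g = G x - G xs] the derivative along [F] is [- <g, g *m S>] plus a term in the increment
    of the bias from [xs]. The latter is [O(eb |x - xs|)] and [|g| >= c / 2 * |x - xs|], so it costs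
    half of the dissipation. *)
Lemma bregman_decay x : D * L * r <= c / 2 -> 8 * D * C2 * eb <= lam * c ->
  'd bregman x (F x) <= - mu * bregman x.
Proof.
move=> hr he; rewrite (proj2 (diff_quadratic_error (bregman_taylor x))).
set g := G x - G xs; set v := x - xs.
have gv : c / 2 * `|v| <= `|g|.
  have h1 := mixed v; have h2 := Gc (xo + v); rewrite (addrAC xo) subrr add0r in h2.
  rewrite (_ : xs + v = x) -/g in h1; last by rewrite addrC subrK.
  have h3 := ler_normB g (g - G (xo + v)); rewrite opprB (addrC g) subrK in h3.
  by have := ler_wpM2r (normr_ge0 v) hr; lra.
have e1 := bias_lipschitz_near x xs1; rewrite -/v in e1.
have e2 : dotp g (F x) <= - (lam / 2) * `|g| ^+ 2.
  rewrite FE -/g dotpDr dotpNr.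
  have h1 := Slam g; rewrite dotpC in h1.
  have h2 := le_trans (ler_norm _) (dotp_le g (bias x - bias xs)).
  have h3 : D * (`|g| * `|bias x - bias xs|) <= lam / 2 * `|g| ^+ 2.
    have h4 : D * (2 * C2 * eb * `|v|) <= lam / 2 * `|g|.
      apply: le_trans (_ : lam / 2 * (c / 2 * `|v|) <= _).
        have := ler_wpM2r (normr_ge0 v) he; lra.
      by apply: ler_wpM2l => //; rewrite divr_ge0// ltW.
    have h5 := ler_wpM2l (normr_ge0 g) (le_trans (ler_wpM2l (ltW D0) e1) h4).
    rewrite mulrCA expr2 (mulrCA (lam / 2)).
    exact: h5.
  lra.
apply: le_trans e2 _; rewrite !mulNr lerN2.
have h1 : (c / 2 * `|v|) ^+ 2 <= `|g| ^+ 2.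
  by rewrite ler_sqr ?nnegrE// mulr_ge0// divr_ge0// ltW.
have mu0 : 0 <= mu.
  by rewrite divr_ge0// ?mulr_ge0// ?exprn_ge0// ltW.
apply: le_trans (ler_wpM2l mu0 (bregman_upper x)) _.
apply: le_trans (_ : lam / 2 * (c / 2 * `|v|) ^+ 2 <= _); last first.
  by apply: ler_wpM2l => //; rewrite divr_ge0// ltW.
rewrite le_eqVlt; apply/orP; left; apply/eqP; rewrite /mu /v; field.
by rewrite nat1r pnatr_eq0 andbT gt_eqF// (lt_le_trans _ L1).
Qed.

Lemma perturbed_exp_stable (K : R) : 0 < K ->
  (forall x y, `|F x - F y| <= K * `|x - y|) ->
  D * (D * L) * r <= k / 2 -> D * L * r <= c / 2 -> 8 * D * C2 * eb <= lam * c ->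
  exp_stable F xs.
Proof.
move=> K0 FK hk hc he; split; first by move=> x0; exact: picard_lindelof FK.
have DLk : 0 <= 2 * (D * L) / k by rewrite divr_ge0// ?mulr_ge0// ltW.
(* The square root of the ratio of the upper and lower constants [D * L] and [k / 2], times [D] for
   the passage to the Euclidean norm; taking roots halves the rate. *)
exists (D * Num.sqrt (2 * (D * L) / k)), (mu / 2); split.
  by rewrite !divr_gt0// !mulr_gt0// ?exprn_gt0// (lt_le_trans _ L1).
move=> y yF t t0.
have dV x : differentiable bregman x by have [] := diff_quadratic_error (bregman_taylor x).
have := lyapunov_decay dV (fun x => bregman_decay x hc he) yF t0.
have := bregman_lower (y t) hk; have := bregman_upper (y 0).
have e0 : 0 <= expR (- (mu * t)) by exact: expR_ge0.
move=> /(ler_wpM2l e0) h1 h2 h3.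
have h4 := le_trans h2 (le_trans h3 h1).
have h5 : `|y t - xs| ^+ 2 <= (Num.sqrt (2 * (D * L) / k) *
    expR (- (mu / 2 * t)) * `|y 0 - xs|) ^+ 2.
  rewrite !exprMn sqr_sqrtr// -expRM_natl.
  have -> : 2%:R * - (mu / 2 * t) = - (mu * t) by field.
  have -> : 2 * (D * L) / k * expR (- (mu * t)) * `|y 0 - xs| ^+ 2 =
     (k / 2)^-1 * (expR (- (mu * t)) * (D * L * `|y 0 - xs| ^+ 2)).
    by field; rewrite gt_eqF.
  by rewrite ler_pdivlMl// divr_gt0.
have s0 : 0 <= Num.sqrt (2 * (D * L) / k) * expR (- (mu / 2 * t)) * `|y 0 - xs|.
  by rewrite mulr_ge0// mulr_ge0 ?sqrtr_ge0 ?expR_ge0.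
rewrite ler_sqr ?nnegrE// in h5.
apply: le_trans (enorm_le _) _.
apply: le_trans (ler_wpM2l (ltW D0) h5) _.
rewrite -!mulrA ler_wpM2l// ler_wpM2l ?sqrtr_ge0// mulrC ler_wpM2r ?expR_ge0//.
exact: le_enorm.
Qed.

(** Near [xs] the field is close to [- w *m S] with [w = v *m H xo], and pairing with [w] yields
    [- lam |w|^2]; the two smallness conditions let the errors consume half of it. *)
Lemma perturbed_negative v : `|v| <= r ->
  2 * D * CS * (D * L) * r <= lam * c0 / 4 -> 2 * D * C2 * eb <= lam * c0 / 4 ->
  dotp (v *m H xo) (F (xs + v)) <= - (lam / 2 * c0 ^+ 2) * `|v| ^+ 2.
Proof.
move=> vr h1 h2; rewrite FE.
set w := v *m H xo; set eta := G (xs + v) - G xs - w.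
have e1 : `|eta| <= D * L * (2 * r) * `|v|.
  have := grad_linear_near (xs + v) xs; rewrite (addrAC xs) subrr add0r.
  move=> /le_trans; apply; rewrite ler_wpM2r// ler_wpM2l ?(ltW DL0)//.
  by rewrite mulr_natl mulr2n lerD.
have e2 := bias_lipschitz_near (xs + v) xs1; rewrite (addrAC xs) subrr add0r in e2.
have -> : G (xs + v) - G xs = w + eta by rewrite /eta [RHS]addrC subrK.
move: (bias (xs + v) - bias xs) e2 => del e2.
rewrite mulmxDl (dotpDr _ del) dotpNr dotpDr.
have e3 := Slam w; rewrite dotpC in e3.
have e4 : - dotp w (eta *m S) <= D * (`|w| * `|eta *m S|).
  by apply: le_trans (dotp_le _ _); rewrite -normrN ler_norm.
have e5 := le_trans (ler_norm _) (dotp_le w del).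
have e6 : `|eta *m S| <= CS * (D * L * (2 * r) * `|v|).
  by apply: le_trans (mulmx_le _ _) _; rewrite ler_wpM2l.
have e7 := lerD e6 e2.
have e8 : D * (CS * (D * L * (2 * r) * `|v|) + 2 * C2 * eb * `|v|) <= lam / 2 * (c0 * `|v|).
  have := ler_wpM2r (normr_ge0 v) h1; have := ler_wpM2r (normr_ge0 v) h2; lra.
have e9 : lam / 2 * (c0 * `|v|) <= lam / 2 * `|w|.
  by apply: ler_wpM2l; [rewrite divr_ge0// ltW|exact: Hexp].
have e10 := ler_wpM2l (normr_ge0 w) (le_trans (ler_wpM2l (ltW D0) e7) (le_trans e8 e9)).
have e11 : (c0 * `|v|) ^+ 2 <= `|w| ^+ 2.
  by rewrite ler_sqr ?nnegrE ?Hexp// mulr_ge0// ltW.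
have e12 : lam / 2 * (c0 * `|v|) ^+ 2 <= lam / 2 * `|w| ^+ 2.
  by apply: ler_wpM2l => //; rewrite divr_ge0// ltW.
rewrite exprMn in e12.
have e13 : `|w| * (D * (`|eta *m S| + `|del|)) =
  D * (`|w| * `|eta *m S|) + D * (`|w| * `|del|) by ring.
have e14 : `|w| * (lam / 2 * `|w|) = lam / 2 * `|w| ^+ 2 by ring.
rewrite e13 e14 in e10.
lra.
Qed.

(** No formula for the Jacobian is needed: it is a limit of difference quotients at [xs], and the
    inequality for the increment [h *: v], divided by [h^2], passes to the limit. *)
Lemma perturbed_hurwitz : differentiable F xs ->
  2 * D * CS * (D * L) * r <= lam * c0 / 4 -> 2 * D * C2 * eb <= lam * c0 / 4 ->
  hurwitz (jac F xs).
Proof.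
move=> dF h1 h2; apply: (hurwitz_lyapunov Hpos) => v v0.
have v00 : 0 < `|v| by rewrite normr_gt0.
set w := v *m H xo.
have dw x : differentiable (dotp w) x by exact: dotp_differentiable.
have dwF : differentiable (dotp w \o F) xs by exact: differentiable_comp.
have dwE x u : 'd (dotp w) x u = dotp w u.
  (* A linear form is its own Taylor expansion, with error constant 0. *)
  apply: (proj2 (diff_quadratic_error (C := 0) _)) => z.
  by rewrite dotpDr (addrAC (dotp w x)) subrr add0r subrr normr0 mul0r.
have <- : 'D_v (dotp w \o F) xs = dotp w (v *m 'J F xs).
  by rewrite -deriveEjacobian// !deriveE// diff_comp//= dwE.
apply: (@le_lt_trans _ _ (- (lam / 2 * c0 ^+ 2) * `|v| ^+ 2)); last first.
  by rewrite mulNr oppr_lt0 !mulr_gt0// ?exprn_gt0// invr_gt0.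
apply: limr_le; first exact: diff_derivable.
near=> h.
have hn0 : h != 0 by near: h; exact: nbhs_dnbhs_neq.
have hr : `|h *: v| <= r.
  rewrite normrZ -ler_pdivlMr// ltW//.
  by near: h; apply: dnbhs0_lt; rewrite divr_gt0.
have := perturbed_negative hr h1 h2; rewrite -scalemxAl dotpZl -/w normrZ.
rewrite exprMn real_normK ?num_real// => hn.
rewrite /= Fxs dotp0r subr0 [_ + xs]addrC.
have h20 : 0 < h ^+ 2 by rewrite exprn_even_gt0.
have -> : h^-1 *: dotp w (F (xs + h *: v)) = (h ^+ 2)^-1 * (h * dotp w (F (xs + h *: v))).
  by rewrite mulrA expr2 invfM mulfVK.
by rewrite ler_pdivrMl// (le_trans hn)// mulrCA.
Unshelve. all: by end_near. Qed.

End zero.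
End perturbed_gradient_field.

(** * The theorem *)

Section constants.
Context {R : realType}.

Lemma lipschitz_bound (V W V' W' : normedModType R) (f : V -> W) (g : V' -> W') :
  lipschitz f -> lipschitz g -> exists2 L : R, 1 <= L &
  (forall x y, `|f x - f y| <= L * `|x - y|) /\
  (forall x y, `|g x - g y| <= L * `|x - y|).
Proof.
move=> [A [_ fA]] [B [_ gB]].
(* The Lipschitz bounds hold for constants strictly above [A] and [B], hence the final [+ 1]. *)
pose L := Num.max 1 (Num.max A B) + 1.
have LA : A < L by rewrite ltr_pwDr// !le_max lexx !orbT.
have LB : B < L by rewrite ltr_pwDr// !le_max lexx !orbT.
exists L; first by rewrite ler_wpDr// le_max lexx.
split=> x y; first exact: (fA L LA (x, y)).
exact: (gB L LB (x, y)).
Qed.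

Lemma small_enough (A B : R) : 0 <= A -> 0 < B ->
  exists2 r0, 0 < r0 & forall r, 0 < r -> r <= r0 -> A * r <= B.
Proof.
move=> A0 B0; have A1 : 0 < A + 1 by rewrite ltr_wpDl.
exists (B / (A + 1)); first by rewrite divr_gt0.
move=> r r0; rewrite ler_pdivlMr// => rB; apply: le_trans rB.
by rewrite mulrC ler_pM2l// lerDl.
Qed.

End constants.

Theorem propositionA2 (R : realType) (d : nat) (Gamma : 'rV[R]_d -> R)
    (alpha : nat -> R) (rho : R)
    (dO : measure_display) (Omega : measurableType dO) (P : probability Omega R)
    (W xi : nat -> Omega -> 'rV[R]_d)
    (theta_opt : 'rV[R]_d) (eps : R -> 'rV[R]_d -> R) :
  step_size_schedule alpha rho ->
  regular_objective Gamma ->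
  exploration_sequence P W xi ->
  stable_gradient_flow Gamma theta_opt ->
  exploration_gain Gamma eps ->
  exists2 eb_a : R, 0 < eb_a &
    forall eb : R, 0 < eb <= eb_a ->
    exists theta_star : 'rV[R]_d, forall n : nat, (1 <= n)%N ->
      let fbar := mean_field P (spsa_field Gamma (eps eb)) (xi n) in
      [/\ fbar theta_star = 0, exp_stable fbar theta_star,
          differentiable fbar theta_star & hurwitz (jac fbar theta_star)].
Proof.
move=> _ [[dGamma dG _] lipG lipH [delta delta0 far]] expl [flow Gxo Hpos] gainP.
set xo := theta_opt in flow Gxo Hpos *.
have [L L1 [GL HL]] := lipschitz_bound lipG lipH.
have [E [M [nE EP]]] := exploration_noise_functional expl.
have [Ke Ke0 eK] := exploration_gain_bound xo L1 dGamma GL gainP.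
have [lam lam0 Slam] := posdef_coercive (noise_posdef nE : posdef (noise_cov E)).
have [c c0 Gc] := grad_coercive L1 dG HL Gxo Hpos delta0 far.
have [k k0 growth] := quadratic_growth L1 dGamma GL Gxo c0 Gc flow.
have [h h0 Hexp] := hessian_expanding Hpos.
have Gxo0 : grad Gamma xo = 0 by exact/Gxo.
have M0 := noise_ge0 nE; have L0 : 0 <= L by exact: le_trans L1.
set D : R := d.+1%:R; have D0 : 0 < D by [].
set CS := D * `|noise_cov E|; have CS0 : 0 <= CS by rewrite mulr_ge0.
set CM := D * `|invmx (hessian Gamma xo *m noise_cov E)|.
have CM0 : 0 <= CM by rewrite mulr_ge0.
have DL0 : 0 <= D * L by rewrite mulr_ge0.
pose Ca := D * (L * M + D * L * M) * Ke * M * M.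
pose Cb := D * L * M * M * Ke * M.
have Ca0 : 0 <= Ca by rewrite !mulr_ge0// ?addr_ge0// ?mulr_ge0// ltW.
have Cb0 : 0 <= Cb by rewrite !mulr_ge0// ltW.
pose C2 := Ca + Cb; have C20 : 0 <= C2 by rewrite addr_ge0.
have q0 : (0 : R) < 4^-1 by rewrite invr_gt0.
(* Conditions on the radius, none involving [eb]: Newton contraction, lower bound of the divergence,
   its decay, and negativity of the Jacobian form. *)
have [r1 r10 hr1] := small_enough
  (mulr_ge0 CM0 (mulr_ge0 CS0 (mulr_ge0 (ler0n R 3) DL0))) q0.
have [r2 r20 hr2] := small_enough (mulr_ge0 (ltW D0) DL0) (divr_gt0 k0 (ltr0Sn R 1)).
have [r3 r30 hr3] := small_enough DL0 (divr_gt0 c0 (ltr0Sn R 1)).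
have lh0 : 0 < lam * h / 4 by rewrite divr_gt0// mulr_gt0.
have [r4 r40 hr4] := small_enough
  (mulr_ge0 (mulr_ge0 (mulr_ge0 (ler0n R 2) (ltW D0)) CS0) DL0) lh0.
have [r [rp re1 [le1 le2 le3 le4]]] :
    exists r, [/\ 0 < r, r <= 1 & [/\ r <= r1, r <= r2, r <= r3 & r <= r4]].
  exists (Num.min 1 (Num.min (Num.min r1 r2) (Num.min r3 r4))).
  by rewrite !lt_min ltr01 r10 r20 r30 r40 !ge_min !lexx !orbT.
(* Conditions on [eb] with [r] now fixed. Only [s2] depends on [r]: it keeps the first Newton step
   within [r / 2]. *)
have [s1 s10 hs1] := small_enough (mulr_ge0 CM0 (mulr_ge0 (ler0n R 2) C20)) q0.
have [s2 s20 hs2] := small_enough (mulr_ge0 CM0 C20) (divr_gt0 rp (ltr0Sn R 1)).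
have [s3 s30 hs3] := small_enough
  (mulr_ge0 (mulr_ge0 (ler0n R 8) (ltW D0)) C20) (mulr_gt0 lam0 c0).
have [s4 s40 hs4] := small_enough (mulr_ge0 (mulr_ge0 (ler0n R 2) (ltW D0)) C20) lh0.
exists (Num.min (Num.min s1 s2) (Num.min s3 s4)).
  by rewrite !lt_min s10 s20 s30 s40.
move=> eb /andP[eb0]; rewrite !le_min => /andP[/andP[es1 es2] /andP[es3 es4]].
have geK := eK _ eb0.
pose F := fbar Gamma E (eps eb).
pose B := bias Gamma E (eps eb).
have FB x : F x = - (grad Gamma x *m noise_cov E) + B x.
  by rewrite /B /bias addrC addrK.
have BL x y : `|B x - B y| <= C2 * (eb * (1 + `|y - xo|) * `|x - y|).
  apply: le_trans (bias_lipschitz L1 dGamma dG GL HL nE eb0 Ke0 geK x y) _.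
  by rewrite ler_wpM2r// ?lerDl// !mulr_ge0 ?addr_ge0// ltW.
have B0 : `|B xo| <= C2 * eb.
  apply: le_trans (bias_at L1 dGamma GL Gxo0 nE eb0 Ke0 geK) _.
  by rewrite ler_wpM2r ?(ltW eb0)// lerDr.
have [K K0 FK] := fbar_lipschitz L1 dGamma GL nE eb0 Ke0 geK.
have dF x : differentiable F x := fbar_differentiable L1 dGamma dG GL nE eb0 Ke0 geK x.
have [xs xsr Fxs] := perturbed_zero L1 dG HL Gxo0 Hpos lam0 Slam eb0 C20
  FB BL B0 rp re1 (hr1 _ rp le1) (hs1 _ eb0 es1) (hs2 _ eb0 es2).
(* The equilibrium is chosen before [n]: it was built from [E], which gives the mean field of every
   [xi n] with [1 <= n]. *)
exists xs => n n1.
have -> : mean_field P (spsa_field Gamma (eps eb)) (xi n) = F.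
  apply/funext => x; apply/rowP => i; rewrite /F /fbar /mean_field 2!mxE.
  by apply: (EP n (fun z => spsa_field Gamma (eps eb) x z 0 i)) => //;
    exact: spsa_field_continuous.
split=> //.
  exact: (perturbed_exp_stable L1 dGamma dG GL HL Gxo0 lam0 Slam c0 Gc k0 growth
    eb0 C20 FB BL rp re1 xsr Fxs K0 FK (hr2 _ rp le2) (hr3 _ rp le3) (hs3 _ eb0 es3)).
exact: (perturbed_hurwitz L1 dG HL Hpos h0 Hexp lam0 Slam eb0 C20 FB BL rp re1 xsr Fxs
  (dF xs) (hr4 _ rp le4) (hs4 _ eb0 es4)).
Qed.
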